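(* For $n\ge0$ define $\Phi,\ \mathrm F_3:\mathfrak S_n\to\mathfrak S_n$ by $\Phi(\sigma)=\mathrm{ZDer}^{-1}({\bf\Phi}(\mathrm{ZDer}(\sigma)))$ and $\mathrm F_3(\sigma)=\mathrm{ZDer}^{-1}({\bf F}_3(\mathrm{ZDer}(\sigma)))$. Then $\Phi$ and $\mathrm F_3$ are bijections of $\mathfrak S_n$ onto itself, and for every $\sigma\in\mathfrak S_n$: $$(\mathrm{fix},\mathrm{RIZE},\mathrm{Der})\,\sigma=(\mathrm{fix},\mathrm{RISE},\mathrm{Der})\,\Phi(\sigma);$$ $$(\mathrm{fix},\mathrm{maz},\mathrm{Der})\,\sigma=(\mathrm{fix},\mathrm{maf},\mathrm{Der})\,\mathrm F_3(\sigma);$$ $$(\mathrm{fix},\mathrm{maj},\mathrm{Der})\,\sigma=(\mathrm{fix},\mathrm{maf},\mathrm{Der})\,\mathrm F_3\circ\Phi^{-1}(\sigma).$$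
   Context: Words have nonnegative integer letters. For $w=x_1\cdots x_n$: $\mathrm{DES}\,w=\{i:1\le i\le n-1,\ x_i>x_{i+1}\}$, $\mathrm{maj}\,w=\sum_{i\in\mathrm{DES}\,w}i$, $\mathrm{RISE}\,w=\{i:1\le i\le n,\ x_i\le x_{i+1}\}$ with $x_{n+1}=+\infty$; $\mathrm{Zero}\,w=\{i:x_i=0\}$, $\mathrm{zero}\,w=\#\mathrm{Zero}\,w$; $\mathrm{Pos}\,w$ is the subword of positive letters; $\mathrm{mafz}\,w=\sum_{i\in\mathrm{Zero}\,w}i-\sum_{i=1}^{\mathrm{zero}\,w}i+\mathrm{maj}\,\mathrm{Pos}\,w$. $\mathrm{Sh}(0^{n-m}v)$ is the set of words of length $n$ with $n-m$ zeros and positive-letter subword $v$. A derangement of order $m$ is a permutation word $y_1\cdots y_m$ of $1,\dots,m$ with $y_i\neq i$ for all $i$. Permutations are words $\sigma(1)\cdots\sigma(n)$; $\mathrm{RISE}\,\sigma$, $\mathrm{DES}\,\sigma$, $\mathrm{maj}\,\sigma$ are as for words (with $\sigma(n+1)=+\infty$); $\mathrm{fix}\,\sigma$ is the number of fixed points. $\mathrm{ZDer}$: for $\sigma\in\mathfrak S_n$ let $j_1<\cdots<j_m$ be the non-fixed points, $\mathrm{red}$ the increasing bijection of $\{j_1,\dots,j_m\}$ onto $\{1,\dots,m\}$; $\mathrm{ZDer}(\sigma)=x_1\cdots x_n$ with $x_i=0$ if $\sigma(i)=i$, $x_i=\mathrm{red}(\sigma(i))$ otherwise. It is a bijection from $\mathfrak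 S_n$ onto the union of the classes $\mathrm{Sh}(0^{n-m}v)$, $0\le m\le n$, $v$ a derangement of order $m$. $\mathrm{Der}\,\sigma=\mathrm{Pos}\,\mathrm{ZDer}(\sigma)$ (a derangement of order $m$). $\mathrm{RIZE}\,\sigma=\mathrm{RISE}\,\mathrm{ZDer}(\sigma)$, $\mathrm{maz}\,\sigma=\mathrm{maj}\,\mathrm{ZDer}(\sigma)$, $\mathrm{maf}\,\sigma=\mathrm{mafz}\,\mathrm{ZDer}(\sigma)$. The map ${\bf\Phi}$ on $\mathrm{Sh}(0^{n-m}v)$, $v$ a derangement of order $m$: for $w=x_1\cdots x_n$ and a position $k$ with $x_k>0$, $\mathrm{red}(k)$ is the number of positive letters among $x_1,\dots,x_k$; $x_k$ is excedent if $x_k>\mathrm{red}(k)$, subexcedent if $x_k<\mathrm{red}(k)$; non-subexcedent means $0$ or excedent; $x_0=x_{n+1}=+\infty$ are regarded as non-subexcedent. For $1\le l\le n$: if $l>n-m$, $\phi_l(w)=w$; otherwise let $j$ be the position of the $l$-th zero of $w$ from the left. (a) If $x_{j-1},x_{j+1}$ are both non-subexcedent, $\phi_l(w)=w$. (b) If $x_{j-1}$ is non-subexcedent and $x_{j+1}$ subexcedent, or both are subexcedent with $x_{j-1}>x_{j+1}$: with $k$ the greatest integer $\ge j+1$ such that $x_{j+1}<\cdots<x_k<\mathrm{red}(k)$, $\phi_l(w)=x_1\cdots x_{j-1}x_{j+1}\cdots x_k\,0\,x_{k+1}\cdots x_n$. (c) If $x_{j-1}$ is subexcedent and $x_{j+1}$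 non-subexcedent, or both are subexcedent with $x_{j-1}<x_{j+1}$: with $i$ the smallest integer $\le j-1$ such that $\mathrm{red}(i)>x_i>\cdots>x_{j-1}$, $\phi_l(w)=x_1\cdots x_{i-1}\,0\,x_i\cdots x_{j-1}x_{j+1}\cdots x_n$. Then ${\bf\Phi}=\phi_1\circ\phi_2\circ\cdots\circ\phi_n$. The map ${\bf F}_3$ on words, by induction on length $n$: if $n\le1$ or all letters except the last are $0$, ${\bf F}_3(w)=w$. Otherwise write uniquely $w=w'a0^rb$ with $a\ge1$ the rightmost positive letter among the first $n-1$ letters, $r\ge0$, $b\ge0$ the last letter. (1) $a\le b$: ${\bf F}_3(w)={\bf F}_3(w'a0^r)b$. (2) $a>b$, $r\ge1$: writing ${\bf F}_3(w'a0^r)=w''c$ with $c$ a letter, ${\bf F}_3(w)=0w''b$. (3) $a>b$, $r=0$: writing ${\bf F}_3(w'a)=0^{m_1}x_1v_1\cdots0^{m_k}x_kv_k$ ($m_1\ge0$, $m_2,\dots,m_k\ge1$, $x_i$ positive letters, $v_i$ possibly empty words of positive letters), ${\bf F}_3(w)=x_10^{m_1}v_1x_20^{m_2}v_2\cdots x_k0^{m_k}v_k\,b$. *)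

(* Defs.v *)
(* Words are [seq nat]; positions are 1-based as in the paper. *)
From mathcomp Require Import all_boot all_fingroup.
Set Implicit Arguments. Unset Strict Implicit. Unset Printing Implicit Defensive.

Definition letter (w : seq nat) (i : nat) : nat := nth 0 w i.-1.

Definition DES (w : seq nat) : seq nat :=
  [seq i <- iota 1 (size w).-1 | letter w i > letter w i.+1].
Definition maj (w : seq nat) : nat := sumn (DES w).
(* RISE w = { i : 1 <= i <= n, x_i <= x_{i+1} } with x_{n+1} = +oo *)
Definition RISE (w : seq nat) : seq nat :=
  [seq i <- iota 1 (size w) | (i == size w) || (letter w i <= letter w i.+1)].
Definition Zero (w : seq nat) : seq nat := [seq i <- iota 1 (size w) | letter w i == 0].
Definition zero (w : seq nat) : nat := size (Zero w).
Definition Pos (w : seq nat) : seq nat := [seq x <- w | 0 < x].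
Definition mafz (w : seq nat) : nat :=
  sumn (Zero w) - sumn (iota 1 (zero w)) + maj (Pos w).

Definition pword n (s : 'S_n) : seq nat := [seq (s i).+1 | i <- enum 'I_n].
Definition fixp n (s : 'S_n) : nat := #|[pred i : 'I_n | s i == i]|.
(* red(v) = number of non-fixed points <= v (0-based indices here) *)
Definition ZDer n (s : 'S_n) : seq nat :=
  [seq (if s i == i then 0 else #|[pred j : 'I_n | (s j != j) && (j <= s i)]|)
   | i <- enum 'I_n].
Definition Der n (s : 'S_n) : seq nat := Pos (ZDer s).
Definition RIZE n (s : 'S_n) : seq nat := RISE (ZDer s).
Definition maz n (s : 'S_n) : nat := maj (ZDer s).
Definition maf n (s : 'S_n) : nat := mafz (ZDer s).
Definition majp n (s : 'S_n) : nat := maj (pword s).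

Definition redw (w : seq nat) (k : nat) : nat := count (fun x => 0 < x) (take k w).
Definition inrange (w : seq nat) (k : nat) : bool := (1 <= k) && (k <= size w).
Definition excedent (w : seq nat) (k : nat) : bool :=
  inrange w k && (0 < letter w k) && (letter w k > redw w k).
Definition subexcedent (w : seq nat) (k : nat) : bool :=
  inrange w k && (0 < letter w k) && (letter w k < redw w k).
(* x_0 = x_{n+1} = +oo are non-subexcedent *)
Definition nonsub (w : seq nat) (k : nat) : bool :=
  ~~ inrange w k || (letter w k == 0) || excedent w k.

Definition incr_seg (w : seq nat) (a b : nat) : bool :=
  all (fun t => letter w t < letter w t.+1) (iota a (b - a)).
Definition decr_seg (w : seq nat) (a b : nat) : bool :=
  all (fun t => letter w t > letter w t.+1) (iota a (b - a)).

Definition phi_l (l : nat) (w : seq nat) : seq nat :=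
  let n := size w in
  let m := count (fun x => 0 < x) w in
  if n - m < l then w else
  let j := nth 0 (Zero w) l.-1 in
  let caseb := (nonsub w j.-1 && subexcedent w j.+1) ||
               (subexcedent w j.-1 && subexcedent w j.+1 &&
                (letter w j.-1 > letter w j.+1)) in
  let casec := (subexcedent w j.-1 && nonsub w j.+1) ||
               (subexcedent w j.-1 && subexcedent w j.+1 &&
                (letter w j.-1 < letter w j.+1)) in
  if nonsub w j.-1 && nonsub w j.+1 then w
  else if caseb then
    let k := foldr maxn 0 [seq k <- iota j.+1 (n - j) |
                             incr_seg w j.+1 k && (letter w k < redw w k)] in
    take j.-1 w ++ drop j (take k w) ++ 0 :: drop k w
  else if casec then
    let i := head 0 [seq i <- iota 1 j.-1 |
                      (redw w i > letter w i) && decr_seg w i j.-1] in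
    take i.-1 w ++ 0 :: drop i.-1 (take j.-1 w) ++ drop j w
  else w.

Definition bfPhi (w : seq nat) : seq nat := foldr phi_l w (iota 1 (size w)).

(* 0^{m1} x1 v1 ... 0^{mk} xk vk  |->  x1 0^{m1} v1 ... xk 0^{mk} vk *)
Fixpoint moveZ (z : nat) (s : seq nat) : seq nat :=
  match s with
  | [::] => nseq z 0
  | x :: s' => if x == 0 then moveZ z.+1 s' else x :: nseq z 0 ++ moveZ 0 s'
  end.

Definition F3step (u Fu : seq nat) (b : nat) : seq nat :=
  if (size u == 0) || all (fun x => x == 0) u then rcons u b else
  let r := find (fun x => x != 0) (rev u) in   (* u = w' a 0^r *)
  let a := nth 0 (rev u) r in
  if a <= b then rcons Fu b
  else if 0 < r then 0 :: take (size Fu).-1 Fu ++ [:: b]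
  else rcons (moveZ 0 Fu) b.

Fixpoint F3rev (rw : seq nat) : seq nat :=
  match rw with
  | [::] => [::]
  | b :: ru => F3step (rev ru) (F3rev ru) b
  end.
Definition bfF3 (w : seq nat) : seq nat := F3rev (rev w).

Definition Phi_perm n (s : 'S_n) : 'S_n :=
  odflt s [pick t : 'S_n | ZDer t == bfPhi (ZDer s)].
Definition F3_perm n (s : 'S_n) : 'S_n :=
  odflt s [pick t : 'S_n | ZDer t == bfF3 (ZDer s)].

(* Main.v *)
Require Import Defs.
From mathcomp Require Import all_boot all_fingroup.
From mathcomp Require Import zify.
Set Implicit Arguments. Unset Strict Implicit. Unset Printing Implicit Defensive.

(** Via ZDer everything happens on words with positive subword a fixed
    derangement.  For Phi, comparing letters of a permutation amounts to letting
    a zero be larger than every subexcedent letter and smaller than every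
    excedent one, whereas RISE of the ZDer word makes it smaller than both.  The
    map phi_l turns the l-th zero, the last one still small, into a large zero
    and moves it over a monotone run of subexcedent letters so that no rise
    changes place; it is injective because the rises determine where a minimal
    letter has been inserted.  For F_3, maj w - maj (Pos w) equals the number of
    pairs (positive letter, later zero) of F_3 w, by induction on the length; the
    last letter and the positive subword tell which of the three cases was
    applied, so F_3 is injective. *)

(** * The map F_3 *)

Definition npos (w : seq nat) : nat := count (fun x => 0 < x) w.

(** Number of pairs formed by a zero and a positive letter to its left, with [p] further positive
    letters imagined in front of the word. *)
Fixpoint posbefore0 (p : nat) (w : seq nat) : nat :=
  if w is x :: w' then
    if x == 0 then p + posbefore0 p w' else posbefore0 p.+1 w'
  else 0.

(** Inverts [moveZ]: [x] is the positive letter read last, held back until the [z] zeros read after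
    it have been written. *)
Fixpoint unmoveZ (x z : nat) (s : seq nat) : seq nat :=
  if s is y :: s' then
    if y == 0 then unmoveZ x z.+1 s' else nseq z 0 ++ x :: unmoveZ y 0 s'
  else nseq z 0 ++ [:: x].

Lemma size_Pos (w : seq nat) : size (Pos w) = npos w.
Proof. exact: size_filter. Qed.

Lemma Pos_cat (s t : seq nat) : Pos (s ++ t) = Pos s ++ Pos t.
Proof. exact: filter_cat. Qed.

Lemma Pos_rcons (u : seq nat) (b : nat) :
  Pos (rcons u b) = if b == 0 then Pos u else rcons (Pos u) b.
Proof. by rewrite /Pos filter_rcons; case: b. Qed.

Lemma Pos_nseq0 (z : nat) : Pos (nseq z 0) = [::].
Proof. by elim: z. Qed.

Lemma letter_rconsl (u : seq nat) (b i : nat) :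
  0 < i <= size u -> letter (rcons u b) i = letter u i.
Proof.
by case: i => // i /andP[_ lti]; rewrite /letter /= nth_rcons lti.
Qed.

Lemma letter_rcons_last (u : seq nat) (b : nat) :
  letter (rcons u b) (size u).+1 = b.
Proof. by rewrite /letter /= nth_rcons ltnn eqxx. Qed.

Lemma maj_rcons (u : seq nat) (b : nat) :
  maj (rcons u b) = maj u + (if last 0 u > b then size u else 0).
Proof.
rewrite /maj /DES size_rcons -pred_Sn.
case/lastP: u => [|u a]; first by [].
rewrite last_rcons size_rcons -pred_Sn.
rewrite -(addn1 (size u)) iotaD filter_cat sumn_cat add1n [iota _.+1 1]/=.
congr (_ + _).
  congr sumn; apply: eq_in_filter => i; rewrite mem_iota => /andP[i1 i2].
  by rewrite !(letter_rconsl b) ?size_rcons; lia.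
have e1 : letter (rcons (rcons u a) b) (size u).+1 = a.
  by rewrite letter_rconsl ?size_rcons //= letter_rcons_last.
have e2 : letter (rcons (rcons u a) b) (size u).+2 = b.
  by have := letter_rcons_last (rcons u a) b; rewrite size_rcons.
rewrite [filter _ _]/= e1 e2.
by case: ifP => //= _; rewrite addn0 addn1.
Qed.

Lemma Zero_rcons (u : seq nat) (b : nat) :
  Zero (rcons u b) = Zero u ++ (if b == 0 then [:: (size u).+1] else [::]).
Proof.
rewrite /Zero size_rcons -[(size u).+1](addn1 (size u)) iotaD filter_cat.
rewrite add1n addn1 [iota _.+1 1]/= [filter _ [:: _]]/= letter_rcons_last.
congr (_ ++ _); apply: eq_in_filter => i; rewrite mem_iota => /andP[i1 i2].
by rewrite letter_rconsl //; lia.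
Qed.

Lemma zero_npos (w : seq nat) : zero w + npos w = size w.
Proof.
elim/last_ind: w => // u b IH.
rewrite /zero Zero_rcons size_cat /npos -cats1 count_cat size_cat -IH /zero /npos.
by case: b => [|b] /=; lia.
Qed.

Lemma posbefore0_cat (p : nat) (s t : seq nat) :
  posbefore0 p (s ++ t) = posbefore0 p s + posbefore0 (p + npos s) t.
Proof.
elim: s p => [|x s IH] p /=; first by rewrite addn0.
rewrite !IH; case: x => [|x] /=; first by rewrite addnA.
by rewrite /npos /= addSnnS.
Qed.

Lemma posbefore0_rcons (p : nat) (u : seq nat) (b : nat) :
  posbefore0 p (rcons u b) =
  posbefore0 p u + (if b == 0 then p + npos u else 0).
Proof. by rewrite -cats1 posbefore0_cat /=; case: b => //=; rewrite addn0. Qed.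

(** The position of the [k]-th zero is [k] plus the number of positive letters before it. *)
Lemma mafzE (w : seq nat) : mafz w = posbefore0 0 w + maj (Pos w).
Proof.
rewrite /mafz; congr (_ + _).
suff -> : sumn (Zero w) = posbefore0 0 w + sumn (iota 1 (zero w)).
  by rewrite addnK.
elim/last_ind: w => // u b IH.
rewrite posbefore0_rcons /zero Zero_rcons sumn_cat IH size_cat.
have := zero_npos u; rewrite /zero; case: b => [|b] /=; last by rewrite !addn0.
by rewrite iotaD sumn_cat /=; lia.
Qed.

Lemma posbefore0_nseq (p z : nat) (s : seq nat) :
  posbefore0 p (nseq z 0 ++ s) = z * p + posbefore0 p s.
Proof. by elim: z => //= z ->; rewrite mulSn addnA. Qed.

Lemma size_moveZ (z : nat) (s : seq nat) : size (moveZ z s) = z + size s.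
Proof.
elim: s z => [|x s IH] z /=; first by rewrite size_nseq addn0.
by case: x => [|x] /=; rewrite ?size_cat ?size_nseq !IH; lia.
Qed.

Lemma Pos_moveZ (z : nat) (s : seq nat) : Pos (moveZ z s) = Pos s.
Proof.
elim: s z => [|x s IH] z /=; first exact: Pos_nseq0.
by case: x => [|x] //=; rewrite Pos_cat Pos_nseq0 IH.
Qed.

(* Every zero passes exactly one positive letter. *)
Lemma posbefore0_moveZ (p z : nat) (s : seq nat) :
  0 < last (nat_of_bool (z == 0)) s ->
  posbefore0 p (moveZ z s) = z + z * p + posbefore0 p s + count (pred1 0) s.
Proof.
elim: s p z => [|x s IH] p z /=; first by case: z.
case: x => [|x] /= last_s.
  rewrite IH; last by case: (s) last_s.
  by rewrite mulSn; move: (posbefore0 p s) (count _ s) => a c; lia.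
rewrite posbefore0_nseq IH; last by case: (s) last_s.
by rewrite mulnS; move: (posbefore0 _ s) (count _ s) => a c; lia.
Qed.

Lemma unmoveZ_nseq (x z k : nat) (s : seq nat) :
  unmoveZ x z (nseq k 0 ++ s) = unmoveZ x (z + k) s.
Proof. by elim: k z => [|k IH] z /=; rewrite ?addn0 // IH addSnnS. Qed.

(** The hypothesis says that [nseq z 0 ++ s] is empty or ends in a positive letter: for empty [s]
    the default of [last] is 1 exactly when no zero is pending. *)
Lemma moveZK (x k z : nat) (s : seq nat) : 0 < last (nat_of_bool (z == 0)) s ->
  unmoveZ x k (moveZ z s) = nseq k 0 ++ x :: nseq z 0 ++ s.
Proof.
elim: s x k z => [|y s IH] x k z /=; first by case: z.
case: y => [|y] /= last_s.
  rewrite IH; last by case: (s) last_s.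
  by congr (_ ++ _ :: _); elim: (z) => //= z' <-.
by rewrite unmoveZ_nseq IH //; case: (s) last_s.
Qed.

Lemma head_moveZ (z : nat) (s : seq nat) :
  0 < last (nat_of_bool (z == 0)) s -> 0 < head 1 (moveZ z s).
Proof.
elim: s z => [|x s IH] z /=; first by case: z.
by case: x => [|x] //= last_s; apply: IH; case: (s) last_s.
Qed.

Lemma moveZ_inj (s t : seq nat) :
  0 < last 1 s -> 0 < last 1 t -> moveZ 0 s = moveZ 0 t -> s = t.
Proof.
move=> hs ht eq_st.
(* The letter 1 is a dummy: [unmoveZ] must start with a held letter and returns it in front of the
   word. *)
have := @moveZK 1 0 0 s hs; rewrite eq_st (@moveZK 1 0 0 t ht) => -[].
by [].
Qed.

(** * The recursion for [bfF3], its statistics and its injectivity *)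

Lemma last_positive (u : seq nat) :
  nth 0 (rev u) (find (fun x => x != 0) (rev u)) = last 0 (Pos u).
Proof.
elim/last_ind: u => // u b IH; rewrite rev_rcons Pos_rcons /=.
by case: b => [|b] //=; rewrite last_rcons.
Qed.

Lemma last_is_positive (u : seq nat) :
  (0 < find (fun x => x != 0) (rev u)) = (u != [::]) && (last 0 u == 0).
Proof.
case/lastP: u => // u b; rewrite rev_rcons last_rcons /=.
by case: b; case: u.
Qed.

Lemma Pos_nil (u : seq nat) : (Pos u == [::]) = all (fun x => x == 0) u.
Proof. by elim: u => //= [[|x]]. Qed.

(** In this form the case distinction involves only [b] and two data of [u] that [bfF3] preserves,
    the positive subword and the last letter. *)
Lemma bfF3_rcons (u : seq nat) (b : nat) :
  bfF3 (rcons u b) =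
  if Pos u == [::] then rcons u b
  else if last 0 (Pos u) <= b then rcons (bfF3 u) b
  else if last 0 u == 0 then 0 :: rcons (take (size (bfF3 u)).-1 (bfF3 u)) b
  else rcons (moveZ 0 (bfF3 u)) b.
Proof.
rewrite /bfF3 rev_rcons /= -/(bfF3 u) /F3step revK size_eq0 Pos_nil.
rewrite last_positive last_is_positive.
case: u => [|x u] //=; case: ifP => // _; case: ifP => // _.
by rewrite cats1.
Qed.

Lemma take_size_rcons (s : seq nat) (c : nat) :
  take (size (rcons s c)).-1 (rcons s c) = s.
Proof. by rewrite size_rcons -cats1 take_size_cat. Qed.

(** The claim on the last letter is needed by the induction: if [u] ends in a zero, it shows that
    the letter cut off from [bfF3 u] is a zero, which the zero put in front replaces. *)
Lemma bfF3_shuffle (w : seq nat) :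
  [/\ size (bfF3 w) = size w, Pos (bfF3 w) = Pos w & last 0 (bfF3 w) = last 0 w].
Proof.
elim/last_ind: w => // u b [IHs IHP IHl]; rewrite bfF3_rcons.
case: ifP => [_|Pu]; first by [].
case: ifP => _; first by rewrite !size_rcons !Pos_rcons IHs IHP !last_rcons.
case: ifP => [/eqP u0|u0]; last first.
  by rewrite !size_rcons !Pos_rcons size_moveZ Pos_moveZ IHs IHP !last_rcons.
have: bfF3 u != [::] by apply: contraFneq Pu => F0; rewrite -IHP F0.
move: IHs IHP IHl; rewrite u0; case/lastP: (bfF3 u) => // s c.
rewrite last_rcons take_size_rcons size_rcons => IHs + c0 _; rewrite c0 => IHP.
rewrite /= last_rcons !size_rcons -IHs; split=> //; last by rewrite last_rcons.
by rewrite !Pos_rcons -IHP Pos_rcons.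
Qed.

Lemma npos_bfF3 (u : seq nat) : npos (bfF3 u) = npos u.
Proof. by rewrite -!size_Pos; case: (bfF3_shuffle u) => _ ->. Qed.

Lemma count0_npos (w : seq nat) : count (pred1 0) w + npos w = size w.
Proof. by elim: w => //= x w; rewrite /npos; case: x => [|x] /= <-; lia. Qed.

(** Let [a] be the last positive letter of [u]. If [a <= b], neither side changes. If [a > b],
    appending [b] adds [npos u] on the right, as pairs with a new zero or as a descent of the
    positive subword. When [u] ends in a zero, moving that zero to the front takes [npos u] away
    again, and no descent is created on the left. Otherwise [moveZ] adds the number of zeros, which
    completes [npos u] to the new descent [size u]. *)
Lemma maj_bfF3 (w : seq nat) : maj w = mafz (bfF3 w).
Proof.
rewrite mafzE; case: (bfF3_shuffle w) => _ -> _.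
elim/last_ind: w => // u b IH.
rewrite bfF3_rcons; case: (bfF3_shuffle u) => Fs FP Fl.
rewrite maj_rcons IH Pos_rcons.
have [P0|Pu] := eqVneq (Pos u) [::].
  have := Pos_nil u; rewrite P0 eqxx => /esym /all_pred1P u0.
  have l0 : last 0 u = 0 by rewrite u0; elim: (size u).
  have n0 : npos u = 0 by rewrite -size_Pos P0.
  have z0 p (s : seq nat) : npos s = 0 -> posbefore0 p s = p * size s.
    elim: s p => [|x s IHs] p; first by rewrite muln0.
    by case: x => //= hn; rewrite IHs // mulnS.
  rewrite posbefore0_rcons l0 n0 (z0 _ (bfF3 u)) ?npos_bfF3 // (z0 _ u) //=.
  by case: b.
have uN : u != [::] by apply: contraNneq Pu => ->.
case: (leqP (last 0 (Pos u)) b) => ab.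
  (* The last letter of [u] is either 0 or its last positive letter. *)
  have lu : last 0 u <= b.
    by case/lastP: (u) ab => // s [|x]; rewrite Pos_rcons !last_rcons.
  have b0 : b != 0.
    move: ab Pu; case: (b) => //; case/lastP E: (Pos u) => [|s x] //.
    rewrite last_rcons leqn0 => /eqP x0.
    have : x \in Pos u by rewrite E mem_rcons mem_head.
    by rewrite x0 mem_filter.
  rewrite posbefore0_rcons (negbTE b0) maj_rcons ltnNge lu ltnNge ab /=; lia.
have [u0|u0] := eqVneq (last 0 u) 0.
  have: bfF3 u != [::] by rewrite -size_eq0 Fs size_eq0.
  rewrite u0 in Fl; have := npos_bfF3 u.
  move: Fl; case/lastP: (bfF3 u) => // s c; rewrite last_rcons => -> nposs _.
  rewrite take_size_rcons //= add0n !posbefore0_rcons /=.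
  move: nposs; rewrite -cats1 /npos count_cat /= !addn0 -/(npos _) => ->.
  rewrite u0 ltn0 -/(npos u).
  by case: (b) ab => [|b'] ab /=; rewrite ?maj_rcons ?ab ?size_Pos; lia.
have lu : last 0 u > b.
  by case/lastP: (u) u0 ab => // s [|x]; rewrite Pos_rcons !last_rcons.
rewrite lu posbefore0_rcons posbefore0_moveZ; last first.
  by case: (bfF3 u) Fl => [|x s] //= ->; rewrite lt0n.
have cF := count0_npos (bfF3 u); rewrite npos_bfF3 Fs in cF.
have -> : npos (moveZ 0 (bfF3 u)) = npos u.
  by rewrite -!size_Pos Pos_moveZ size_Pos npos_bfF3 size_Pos.
rewrite -cF; move: (count _ _) => z.
by case: (b) ab => [|b'] ab /=; rewrite ?maj_rcons ?ab ?size_Pos; lia.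
Qed.

(** The image shows [b] as its last letter, and [Pos] gives the last positive letter [a] of [u].
    When [a > b], the image starts with a zero if [u] ends in one and with a positive letter
    otherwise. *)
Lemma bfF3_inj (w1 w2 : seq nat) :
  Pos w1 = Pos w2 -> bfF3 w1 = bfF3 w2 -> w1 = w2.
Proof.
elim/last_ind: w1 w2 => [|u b IH] w2.
  by move=> _ eqF; case: (bfF3_shuffle w2); rewrite -eqF => /esym/size0nil ->.
case/lastP: w2 => [|u2 b2].
  by move=> _ eqF; case: (bfF3_shuffle (rcons u b)); rewrite eqF size_rcons.
move=> eqPos eqF.
have eb : b2 = b.
  case: (bfF3_shuffle (rcons u b)) => _ _; rewrite eqF.
  by case: (bfF3_shuffle (rcons u2 b2)) => _ _ ->; rewrite !last_rcons.
have eqPu : Pos u = Pos u2.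
  move: eqPos; rewrite !Pos_rcons eb; case: ifP => // _ /rcons_inj[].
  by [].
congr rcons => //; move: eqF; rewrite !bfF3_rcons eb -eqPu.
case: ifP => [_ /rcons_inj[]//|Pu].
case: ifP => [_ /rcons_inj[] /(IH _ eqPu) //|ab].
case: (bfF3_shuffle u) => Fs FP Fl; case: (bfF3_shuffle u2) => Fs2 FP2 Fl2.
have F0 : bfF3 u != [::] by apply: contraFneq Pu => F0; rewrite -FP F0.
have F20 : bfF3 u2 != [::] by apply: contraFneq Pu => F20; rewrite eqPu -FP2 F20.
have F_last v : bfF3 v != [::] -> last 0 (bfF3 v) = 0 ->
    bfF3 v = rcons (take (size (bfF3 v)).-1 (bfF3 v)) 0.
  case/lastP: (bfF3 v) => // s c _; rewrite last_rcons => ->.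
  by rewrite take_size_rcons.
have lastF v : bfF3 v != [::] -> last 0 v != 0 -> 0 < last 1 (bfF3 v).
  case: (bfF3_shuffle v) => _ _ <-; rewrite lt0n.
  by case: (bfF3 v).
have ZF v : bfF3 v != [::] -> last 0 v != 0 ->
    forall s, rcons (moveZ 0 (bfF3 v)) b <> 0 :: s.
  move=> vN lv s; have := @head_moveZ 0 _ (lastF v vN lv).
  have := size_moveZ 0 (bfF3 v); rewrite add0n.
  case: (moveZ 0 _) => [/esym/size0nil v0|[|x] t] //=.
  by rewrite v0 in vN.
case: ifP => u0; case: ifP => u20.
- case=> /rcons_inj [eq_take]; apply: IH => //.
  rewrite (F_last _ F0) ?Fl ?eq_take; last by apply/eqP.
  by rewrite -F_last // Fl2; apply/eqP.
- by move=> /esym /ZF => /(_ F20 (negbT u20)).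
- by move=> /ZF => /(_ F0 (negbT u0)).
- move=> /rcons_inj [/moveZ_inj eqF]; apply: IH => //.
  by apply: eqF; apply: lastF => //; apply: negbT.
Qed.

(** * The words ZDer *)

(* [p] counts the positive letters already read. *)
Fixpoint derange (p : nat) (w : seq nat) : bool :=
  if w is x :: w' then
    if x == 0 then derange p w' else (x != p.+1) && derange p.+1 w'
  else true.

Lemma derange_Pos (p : nat) (w : seq nat) : derange p (Pos w) = derange p w.
Proof. by elim: w p => //= [[|x]] w IH p //=; rewrite IH. Qed.

Lemma derangeP (p : nat) (w : seq nat) :
  reflect (forall i, i < size w -> 0 < nth 0 w i -> nth 0 w i != p + redw w i.+1)
          (derange p w).
Proof.
elim: w p => [|x w IH] p /=; first by left.
case: x => [|x] /=.
  apply: (iffP (IH p)) => H; first by case=> [|i] //=; apply: H.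
  by move=> i lti wi; apply: (H i.+1).
apply: (iffP andP) => [[H1 /IH H2] [|i] //=|H].
- by rewrite /redw /= take0 addn1.
- by move=> lti wi; rewrite /redw /= add1n -addSnnS; apply: H2.
split; first by have := H 0 isT isT; rewrite /redw /= take0 addn1.
apply/IH => i lti wi.
by have := H i.+1 lti wi; rewrite /redw /= add1n -addSnnS.
Qed.

Lemma redw_leq (w : seq nat) (i j : nat) : i <= j -> redw w i <= redw w j.
Proof.
move=> leij; rewrite /redw -(subnKC leij) takeD count_cat; exact: leq_addr.
Qed.

Lemma redwS (w : seq nat) (i : nat) : redw w i.+1 = redw w i + (0 < nth 0 w i).
Proof.
rewrite /redw; case: (ltnP i (size w)) => [lti|lei].
  by rewrite (take_nth 0 lti) -cats1 count_cat /= addn0.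
by rewrite !take_oversize ?nth_default ?addn0 // ltnW.
Qed.

Lemma redw_inj (w : seq nat) (i j : nat) :
  0 < nth 0 w i -> 0 < nth 0 w j -> redw w i.+1 = redw w j.+1 -> i = j.
Proof.
wlog leij : i j / i <= j => [H wi wj e|wi wj].
  by case: (leqP i j) => [|/ltnW] le; [apply: H|symmetry; apply: H].
rewrite (redwS w j) wj => e; apply/eqP; rewrite eqn_leq leij leqNgt.
by apply/negP => /(redw_leq w); rewrite e; lia.
Qed.

Lemma redw_onto (w : seq nat) (k : nat) : 0 < k <= npos w ->
  exists i, [/\ i < size w, 0 < nth 0 w i & redw w i.+1 = k].
Proof.
elim: w k => [|x w IH] k; first by rewrite /npos /=; lia.
rewrite /npos /= -/(npos w) => hk.
have [/andP[x0 /eqP->]|hx] := boolP ((0 < x) && (k == 1)).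
  by exists 0; split=> //=; rewrite /redw /= take0 x0.
case: (IH (k - (0 < x))) => [|i [lti wi e]]; first by case: (x) hx hk => /=; lia.
exists i.+1; split=> //; move: e; rewrite /redw /= => ->; lia.
Qed.

Lemma card_redw n (w : seq nat) (x : nat) : size w = n -> x < n ->
  #|[pred j : 'I_n | (0 < nth 0 w j) && (j <= x)]| = redw w x.+1.
Proof.
move=> sw ltx; rewrite cardE size_filter -enumT.
rewrite (@eq_count _ _ (preim (@nat_of_ord n) (fun j => (0 < nth 0 w j) && (j < x.+1)))) //.
rewrite -count_map val_enum_ord -(subnKC ltx) iotaD count_cat add0n.
rewrite [X in _ + X](@eq_in_count _ _ pred0); last first.
  by move=> j; rewrite mem_iota => /andP[lej _]; rewrite [j < _]ltnNge lej andbF.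
rewrite count_pred0 addn0 /redw -[in RHS](mkseq_nth 0 w) /mkseq -map_take count_map.
rewrite take_iota sw (minn_idPl ltx); apply: eq_in_count => j.
by rewrite mem_iota /= add0n => /= ->; rewrite andbT.
Qed.

(* [redw w] ranks the non-fixed points of [t]. *)
Definition ZDer_of n (t : 'S_n) (w : seq nat) : Prop :=
  size w = n /\
  forall i : 'I_n, (nth 0 w i == 0) = (t i == i) /\
    (0 < nth 0 w i -> redw w (t i).+1 = nth 0 w i).

Lemma nth_ZDer n (t : 'S_n) (i : 'I_n) : nth 0 (ZDer t) i =
  if t i == i then 0 else #|[pred j : 'I_n | (t j != j) && (j <= t i)]|.
Proof.
rewrite /ZDer (nth_map i) ?size_enum_ord //; first by rewrite nth_ord_enum.
Qed.

Lemma size_ZDer n (t : 'S_n) : size (ZDer t) = n.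
Proof. by rewrite size_map size_enum_ord. Qed.

(** The non-fixed points are the positions of the positive letters, so the ranks in the definition
    of [ZDer] are prefix counts of the word itself. This replaces cardinals by [redw] from here
    on. *)
Lemma ZDer_ofP n (t : 'S_n) (w : seq nat) : ZDer t = w <-> ZDer_of t w.
Proof.
have H0 (i : 'I_n) : (nth 0 (ZDer t) i == 0) = (t i == i).
  rewrite nth_ZDer; have [//|ti] := eqVneq (t i) i; apply/negbTE; rewrite -lt0n.
  by apply/card_gt0P; exists (t i); rewrite inE leqnn andbT (inj_eq perm_inj).
have card_w (v : seq nat) : size v = n ->
    (forall i : 'I_n, (nth 0 v i == 0) = (t i == i)) ->
    forall i : 'I_n, #|[pred j : 'I_n | (t j != j) && (j <= t i)]| = redw v (t i).+1.
  move=> sv hv i; rewrite -(card_redw sv) //; apply: eq_card => j.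
  by rewrite !inE -hv lt0n.
split=> [<-|[sw hw]].
  split=> [|i]; first exact: size_ZDer.
  split=> //; rewrite lt0n H0 => ti.
  by rewrite nth_ZDer (negbTE ti) (card_w (ZDer t)) ?size_ZDer.
apply: (@eq_from_nth _ 0); rewrite size_ZDer // => i lti.
rewrite -[i]/(nat_of_ord (Ordinal lti)); move: (Ordinal lti) => {lti} {}i.
rewrite nth_ZDer; case: (hw i) => <-; rewrite lt0n.
case: eqVneq => // _ /(_ isT) <-.
by apply: card_w => // j; case: (hw j).
Qed.

Lemma ZDer_inj n : injective (@ZDer n).
Proof.
move=> s t; set w := ZDer t => /ZDer_ofP [sw hs].
have [_ ht] : ZDer_of t w by apply/ZDer_ofP.
apply/permP => i; case: (hs i) (ht i) => s0 sr [t0 tr].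
have [w0|w0] := boolP (nth 0 w i == 0).
  by move: s0 t0; rewrite w0 => /esym/eqP -> /esym/eqP ->.
have wp : 0 < nth 0 w i by rewrite lt0n.
(* A permutation maps non-fixed points to non-fixed points, and [redw] is injective on those. *)
apply/val_inj/(@redw_inj w); last by rewrite sr ?tr.
  by rewrite lt0n (hs _).1 (inj_eq perm_inj) -s0.
by rewrite lt0n (ht _).1 (inj_eq perm_inj) -t0.
Qed.

Lemma nth_Pos_redw (w : seq nat) (i : nat) : 0 < nth 0 w i ->
  nth 0 (Pos w) (redw w i) = nth 0 w i.
Proof.
elim: w i => [|x w IH] [|i] //=; first by rewrite /redw take0 /=; case: x.
by rewrite /redw /=; case: x => [|x] /= wi; apply: IH.
Qed.

Definition derangement_word (v : seq nat) : bool :=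
  [&& uniq v, derange 0 v & all (fun x => x <= size v) v].

Lemma npos_redw (w : seq nat) : npos w = redw w (size w).
Proof. by rewrite /npos /redw take_size. Qed.

Lemma uniq_Pos (w : seq nat) :
  (forall i j, 0 < nth 0 w i -> nth 0 w i = nth 0 w j -> i = j) -> uniq (Pos w).
Proof.
elim: w => //= x w IH H.
have {}IH : uniq (Pos w).
  by apply: IH => i j wi e; have [] := H i.+1 j.+1 wi e.
case: x H => //= x H; rewrite IH andbT mem_filter /=.
by apply/negP => /(nthP 0) [i _ e]; have := H 0 i.+1 isT (esym e).
Qed.

(** Ranks separate non-fixed points: equal positive letters force equal values of [t], and a letter
    equal to its own rank would sit at a fixed point. *)
Lemma Der_derangement n (t : 'S_n) : derangement_word (Der t).
Proof.
rewrite /Der; set w := ZDer t; have [sw hw] : ZDer_of t w by apply/ZDer_ofP.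
have hwi i : 0 < nth 0 w i -> i < n.
  by rewrite -sw; case: (ltnP i (size w)) => // /(nth_default 0) ->.
rewrite /derangement_word derange_Pos size_Pos; apply/and3P; split.
- apply: uniq_Pos => i j wi e; have wj : 0 < nth 0 w j by rewrite -e.
  have [_ /(_ wi) ri] := hw (Ordinal (hwi _ wi)).
  have [_ /(_ wj) rj] := hw (Ordinal (hwi _ wj)).
  have /= := ri; rewrite e -[in RHS]rj /= => /redw_inj.
  have tpos (k : 'I_n) : 0 < nth 0 w k -> 0 < nth 0 w (t k).
    by rewrite !lt0n !(hw _).1 (inj_eq perm_inj).
  by move=> /(_ (tpos (Ordinal _) wi) (tpos (Ordinal _) wj)) /val_inj/perm_inj [].
- apply/derangeP => i; rewrite sw => lti wi; rewrite add0n.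
  have [i0 /(_ wi) /= <-] := hw (Ordinal lti); apply/eqP => /redw_inj.
  have := wi; rewrite lt0n i0 => ti.
  rewrite lt0n (hw _).1 (inj_eq perm_inj) => /(_ ti ti) e.
  by case/eqP: ti; apply: val_inj.
- apply/allP => x; rewrite mem_filter => /andP[x0 /(nthP 0) [i lti xi]].
  rewrite sw in lti; have := (hw (Ordinal lti)).2; rewrite /= xi => /(_ x0) <-.
  by rewrite npos_redw sw; apply: redw_leq.
Qed.

(** The preimage fixes the positions of zeros and sends the position of a positive letter [x] to
    that of the [x]-th positive letter. Distinct letters make it injective; the derangement
    condition prevents further fixed points. *)
Lemma ZDer_onto n (w : seq nat) : size w = n -> derangement_word (Pos w) ->
  exists t : 'S_n, ZDer t = w.
Proof.
move=> sw /and3P[uw]; rewrite derange_Pos size_Pos => /derangeP dw /allP mw.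
have wle (i : 'I_n) : 0 < nth 0 w i -> 0 < nth 0 w i <= npos w.
  move=> wi; rewrite wi; apply: mw; rewrite mem_filter wi.
  by rewrite mem_nth // sw.
(* The default [i] is never taken, since [redw_onto] provides a position of every rank up to
   [npos w]. *)
pose f (i : 'I_n) : 'I_n := if nth 0 w i == 0 then i else
  odflt i [pick j : 'I_n | (0 < nth 0 w j) && (redw w j.+1 == nth 0 w i)].
have f0 (i : 'I_n) : nth 0 w i = 0 -> f i = i by rewrite /f => ->.
have fP (i : 'I_n) : 0 < nth 0 w i -> 0 < nth 0 w (f i) /\ redw w (f i).+1 = nth 0 w i.
  move=> wi; rewrite /f gtn_eqF //; case: pickP => [j /andP[-> /eqP ->] //|].
  have [k [ltk wk rk]] := redw_onto (wle i wi); rewrite sw in ltk.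
  by move=> /(_ (Ordinal ltk)); rewrite /= wk rk eqxx.
have finj : injective f.
  move=> i j e.
  have [wi|wi] := posnP (nth 0 w i); have [wj|wj] := posnP (nth 0 w j).
  - by rewrite -(f0 _ wi) -(f0 _ wj).
  - by have [] := fP _ wj; rewrite -e f0 // wi.
  - by have [] := fP _ wi; rewrite e f0 // wj.
  have [_ ri] := fP _ wi; have [_ rj] := fP _ wj.
  have e2 : nth 0 w i = nth 0 w j by rewrite -ri -rj e.
  apply/val_inj/(redw_inj wi wj).
  have := nth_Pos_redw wi; rewrite e2 -(nth_Pos_redw wj) => /eqP.
  have lt_redw (k : 'I_n) : 0 < nth 0 w k -> redw w k < size (Pos w).
    rewrite size_Pos npos_redw sw => wk.
    by have := redw_leq w (ltn_ord k); rewrite redwS wk addn1.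
  by rewrite nth_uniq ?lt_redw // !redwS wi wj => /eqP ->.
exists (perm finj); apply/ZDer_ofP; split=> // i; rewrite permE.
have [wi|wi] := posnP (nth 0 w i); first by rewrite wi f0 ?eqxx.
have [wf rf] := fP _ wi; split=> //; apply/esym/negbTE.
apply/eqP => fi; have := dw i; rewrite sw wi add0n -rf fi eqxx.
by move/(_ (ltn_ord i) isT).
Qed.

(** * Rises of words with small and large zeros *)

Lemma zero_count (w : seq nat) : zero w = count (pred1 0) w.
Proof. by apply/eqP; rewrite -(eqn_add2r (npos w)) zero_npos count0_npos. Qed.

Lemma npos_cat (s t : seq nat) : npos (s ++ t) = npos s + npos t.
Proof. exact: count_cat. Qed.

Lemma zero_cat (s t : seq nat) : zero (s ++ t) = zero s + zero t.
Proof. by rewrite !zero_count count_cat. Qed.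

Lemma zero_cons (x : nat) (s : seq nat) : zero (x :: s) = (x == 0) + zero s.
Proof. by rewrite !zero_count. Qed.

(* The first [z] zeros are small (key 0), the others large (key [M]), a
   subexcedent letter [x < M] keeps its value and any other positive letter gets
   [M + x]; [p] counts the positive letters already read. *)
Fixpoint keys (M p z : nat) (w : seq nat) : seq nat :=
  if w is x :: w' then
    if x == 0 then
      if z is z'.+1 then 0 :: keys M p z' w' else M :: keys M p 0 w'
    else (if x < p.+1 then x else M + x) :: keys M p.+1 z w'
  else [::].

Lemma keys_cat (M p z : nat) (s t : seq nat) :
  keys M p z (s ++ t) = keys M p z s ++ keys M (p + npos s) (z - zero s) t.
Proof.
elim: s p z => [|x s IH] p z; first by rewrite addn0 subn0.
rewrite zero_cons /npos /= -/(npos s).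
case: x => [|x] /=; last by rewrite IH add0n addSnnS.
by case: z => [|z]; rewrite IH // add1n subSS.
Qed.

Lemma size_keys (M p z : nat) (w : seq nat) : size (keys M p z w) = size w.
Proof. by elim: w p z => //= x w IH p z; case: ifP; case: z => /= *; rewrite IH. Qed.

Lemma keys_zero (M p z z' : nat) (w : seq nat) :
  zero w <= z -> zero w <= z' -> keys M p z w = keys M p z' w.
Proof.
elim: w p z z' => // x w IH p z z'; rewrite zero_cons /=.
case: x => [|x] /=; last by move=> h h'; rewrite (IH _ z z').
by case: z => // z; case: z' => // z' h h'; rewrite (IH _ z z').
Qed.

Lemma nth_keys (M p z : nat) (w : seq nat) (i : nat) : i < size w ->
  nth 0 (keys M p z w) i =
  if nth 0 w i == 0 then (if zero (take i w) < z then 0 else M)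
  else if nth 0 w i < p + redw w i.+1 then nth 0 w i else M + nth 0 w i.
Proof.
elim: w p z i => // x w IH p z [|i] /=.
  by case: x => [|x] /=; case: z => [|z] //=; rewrite /redw /= take0 addn1.
rewrite ltnS zero_cons => lti.
have -> : p + redw (x :: w) i.+2 = p + (0 < x) + redw w i.+1 by rewrite -addnA.
case: x => [|x] /=; last by rewrite IH // addn1.
by case: z => [|z] /=; rewrite IH // addn0.
Qed.

Definition unkey (M x : nat) : nat :=
  if x < M then x else x - M.

(** Keys below [M] are the letters themselves; the others are letters shifted by [M], a large zero
    being the shift of 0. *)
Lemma keysK (M p z : nat) (w : seq nat) :
  all (fun x => x < M) w -> map (unkey M) (keys M p z w) = w.
Proof.
elim: w p z => //= x w IH p z /andP[xM wM].
case: x xM => [|x] xM /=.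
  by case: z => [|z] /=; rewrite IH // /unkey ?ltnn ?subnn //= (leq_trans _ xM).
rewrite IH // /unkey; congr (_ :: _); case: (ltnP x.+1 p.+1) => _.
  by rewrite xM.
by rewrite ltnNge leq_addr /= addKn.
Qed.

Lemma keys_pos (M p z x : nat) (w : seq nat) : 0 < x ->
  keys M p z (x :: w) = (if x < p.+1 then x else M + x) :: keys M p.+1 z w.
Proof. by case: x. Qed.

(** Going left in an increasing run, letters drop by at least one and ranks by exactly one. Hence
    subexcedence of the last letter spreads to the whole run. *)
Lemma keys_incr (M r z x : nat) (c : seq nat) : 0 < x -> path ltn x c ->
  last x c < r + (size c).+1 -> x < r.+1 /\ keys M r z (x :: c) = x :: c.
Proof.
elim: c r x => [|y c IH] r x x0; first by rewrite keys_pos //= addn1 => _ ->.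
rewrite [path _ _ _]/= [last _ _]/= [size _]/= => /andP[xy yc] h.
have [|yr e] := IH r.+1 y (ltn_trans x0 xy) yc; first by rewrite addSnnS.
by rewrite keys_pos // e (leq_trans xy).
Qed.

(** Going right in a decreasing run, letters drop while ranks grow, so subexcedence of the first
    letter suffices. *)
Lemma keys_decr (M r z x : nat) (c : seq nat) : 0 < last x c -> path gtn x c ->
  x < r.+1 -> 0 < x /\ keys M r z (x :: c) = x :: c.
Proof.
elim: c r x => [|y c IH] r x; first by move=> x0 _ xr; rewrite keys_pos // xr.
rewrite [path _ _ _]/= [last _ _]/= => l0 /andP[yx yc] xr.
have [|y0 e] := IH r.+1 y l0 yc; first exact: ltn_trans yx (leqW xr).
have x0 : 0 < x by apply: ltn_trans yx.
by rewrite keys_pos // e xr.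
Qed.

(** * Rise patterns when a small zero becomes large and moves *)

Lemma pairmap_incr (x : nat) (c : seq nat) :
  path ltn x c -> pairmap leq x c = nseq (size c) true.
Proof. by elim: c x => //= y c IH x /andP[/ltnW -> /IH ->]. Qed.

Lemma pairmap_decr (x : nat) (c : seq nat) :
  path gtn x c -> pairmap leq x c = nseq (size c) false.
Proof. by elim: c x => //= y c IH x /andP[/= yx /IH ->]; rewrite leqNgt yx. Qed.

Lemma nseq_rot (T : Type) (k : nat) (b : T) (s : seq T) :
  b :: nseq k b ++ s = nseq k b ++ b :: s.
Proof. by elim: k => //= k ->. Qed.

(** The small zero gives a rise before the increasing run, the large zero a rise after it, so the
    pattern is the same block of rises. The last two hypotheses make the comparisons at both ends of
    the block agree. *)
Lemma rises_right (M I0 x e : nat) (P C E : seq nat) :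
  0 < x -> path ltn x C -> last x C < M ->
  (last I0 P == 0) || (x < last I0 P) -> (M <= e) || (e < last x C) ->
  pairmap leq I0 (P ++ 0 :: (x :: C) ++ e :: E) =
  pairmap leq I0 (P ++ (x :: C) ++ M :: e :: E).
Proof.
move=> x0 xC CM aP eC; rewrite !pairmap_cat; congr (_ ++ _) => /=.
rewrite !pairmap_cat /= pairmap_incr // (ltnW CM).
have -> : (M <= e) = (last x C <= e) by lia.
have -> : (last I0 P <= x) = (last I0 P <= 0) by lia.
by congr (_ :: _); rewrite nseq_rot.
Qed.

(** Dual to [rises_right]: a descent to the small zero after the decreasing run is traded for a
    descent from the large zero before it. *)
Lemma rises_left (M I0 x e : nat) (P C E : seq nat) :
  0 < last x C -> path gtn x C -> x < M ->
  (M < last I0 P) || (last I0 P < x) -> last x C < e ->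
  pairmap leq I0 (P ++ (x :: C) ++ 0 :: e :: E) =
  pairmap leq I0 (P ++ M :: (x :: C) ++ e :: E).
Proof.
move=> C0 xC xM aP eC; rewrite !pairmap_cat; congr (_ ++ _) => /=.
rewrite !pairmap_cat /= pairmap_decr // (ltnW eC).
have -> : (last x C <= 0) = false by lia.
have -> : (M <= x) = false by lia.
have -> : (last I0 P <= x) = (last I0 P <= M) by lia.
by congr (_ :: _); rewrite nseq_rot.
Qed.

Lemma rises_stay (M I0 e : nat) (P E : seq nat) :
  (M < last I0 P) || (last I0 P == 0) -> M <= e ->
  pairmap leq I0 (P ++ 0 :: e :: E) = pairmap leq I0 (P ++ M :: e :: E).
Proof.
move=> aP Me; rewrite !pairmap_cat; congr (_ ++ _) => /=.
by rewrite Me; congr (_ :: _); lia.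
Qed.

Lemma cons_rcons_last (T : Type) (b c : T) (s : seq T) :
  b :: s = rcons s c -> c = b.
Proof. by elim: s b => [|x s IH] b /= [] // -> /IH. Qed.

Lemma pairmap_rcons (T S : Type) (f : T -> T -> S) (a y : T) (s : seq T) :
  pairmap f a (rcons s y) = rcons (pairmap f a s) (f (last a s) y).
Proof. by rewrite -!cats1 pairmap_cat. Qed.

(** The steps inside [T] come after the rise from 0 on one side and before the step down to 0 on the
    other. Comparing the two lists, that final step must be a rise too, so [T] ends in 0; this zero
    is removed and the argument repeats. *)
Lemma pairmap_insert0 (a : nat) (T : seq nat) :
  pairmap leq a (0 :: T) = pairmap leq a (rcons T 0) -> 0 :: T = rcons T 0.
Proof.
elim/last_ind: T a => // T t IH a H.
have t0 : t = 0.
  move: H; rewrite [in RHS]pairmap_rcons last_rcons.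
  case E: (rcons T t) => [|h T'']; first by case: (T) E.
  rewrite /= => {}H.
  have : true :: pairmap leq h T'' = rcons (pairmap leq h T'') (t <= 0) by case: H.
  by move=> H2; have := cons_rcons_last H2; case: (t).
move: H; rewrite t0 -rcons_cons !pairmap_rcons => /rcons_inj[].
by rewrite -pairmap_rcons => /IH ->.
Qed.

(** The rises determine where a minimal letter was inserted. Outside the factor [T] between the two
    insertion places the words coincide, which leaves the situation of [pairmap_insert0]. *)
Lemma pairmap_insert (a : nat) (P Q P2 Q2 : seq nat) : P ++ Q = P2 ++ Q2 ->
  pairmap leq a (P ++ 0 :: Q) = pairmap leq a (P2 ++ 0 :: Q2) ->
  P ++ 0 :: Q = P2 ++ 0 :: Q2.
Proof.
wlog leP : P Q P2 Q2 / size P <= size P2 => [H|].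
  by case: (leqP (size P) (size P2)) => [|/ltnW] le *; [apply: H|symmetry; apply: H].
move=> e; have eP : P = take (size P) P2.
  by have := congr1 (take (size P)) e; rewrite take_size_cat // takel_cat.
move: e; rewrite -(cat_take_drop (size P) P2) -eP -catA => /eqP.
rewrite eqseq_cat // eqxx /= => /eqP ->; move: (drop _ _) => T.
rewrite -!catA ![pairmap _ _ (P ++ _)]pairmap_cat => /eqP.
rewrite eqseq_cat // eqxx /= -/(pairmap leq _ (0 :: T ++ Q2)) => /eqP.
move: (last a P) => b; rewrite -cat_cons -cat_rcons !pairmap_cat => /eqP.
rewrite eqseq_cat; last by rewrite !size_pairmap size_rcons.
by case/andP=> /eqP/pairmap_insert0 -> _.
Qed.

(** * The three cases of phi_l *)

Lemma split_zero (l : nat) (w : seq nat) : l < zero w ->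
  exists p q, w = p ++ 0 :: q /\ zero p = l.
Proof.
elim: w l => // x w IH l; rewrite zero_cons; case: x => [|x] /=.
  case: l => [|l] lt; first by exists [::], w.
  have [|p [q [-> zp]]] := IH l; first by [].
  by exists (0 :: p), q; rewrite zero_cons zp.
rewrite add0n => /IH [p [q [-> zp]]].
by exists (x.+1 :: p), q; rewrite zero_cons zp.
Qed.

Lemma nth_Zero (p q : seq nat) : nth 0 (Zero (p ++ 0 :: q)) (zero p) = (size p).+1.
Proof.
have zp : [seq i <- iota 1 (size p) | letter (p ++ 0 :: q) i == 0] = Zero p.
  apply: eq_in_filter => i; rewrite mem_iota => /andP[i1 i2].
  by rewrite /letter nth_cat; case: ifP => //; lia.
rewrite /Zero size_cat iotaD filter_cat zp nth_cat -/(zero p) ltnn subnn add1n /=.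
by rewrite {1}/letter /= nth_cat ltnn subnn.
Qed.

Lemma letter_catl (p s : seq nat) (i : nat) :
  0 < i <= size p -> letter (p ++ s) i = letter p i.
Proof. by move=> h; rewrite /letter nth_cat ifT //; lia. Qed.

Lemma letter_catr (p q : seq nat) (i : nat) :
  letter (p ++ 0 :: q) ((size p).+2 + i) = nth 0 q i.
Proof.
by rewrite /letter addSn /= nth_cat ltnNge leqW ?leq_addr //= addSn subSn ?leq_addr // addKn.
Qed.

Lemma redw_catl (p s : seq nat) (i : nat) : i <= size p -> redw (p ++ s) i = redw p i.
Proof. by move=> h; rewrite /redw takel_cat. Qed.

Lemma redw_catr (p q : seq nat) (i : nat) :
  redw (p ++ 0 :: q) ((size p).+1 + i) = npos p + redw q i.
Proof.
rewrite /redw take_cat ltnNge leqW ?leq_addr //= addSn subSn ?leq_addr // addKn.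
by rewrite count_cat.
Qed.

(** Subexcedence of the left neighbour of the zero in [p ++ 0 :: q], and in [sub_right] of the right
    one with [r] positive letters before it. The default 0 makes a missing neighbour
    non-subexcedent, as the convention at both ends demands. *)
Definition sub_left (p : seq nat) : bool := 0 < last 0 p < npos p.
Definition sub_right (r : nat) (q : seq nat) : bool := 0 < head 0 q < r.+1.

Lemma letter_last (p q : seq nat) : p != [::] ->
  letter (p ++ q) (size p) = last 0 p.
Proof.
case/lastP: p => // p x _; rewrite last_rcons size_rcons cat_rcons /letter /=.
by rewrite nth_cat ltnn subnn.
Qed.

Lemma subexcedent_left (p q : seq nat) :
  subexcedent (p ++ 0 :: q) (size p) = sub_left p.
Proof.
rewrite /subexcedent /sub_left; case: (eqVneq p [::]) => [->|pN] //.
rewrite letter_last // redw_catl // /redw take_size /inrange size_cat.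
by rewrite lt0n size_eq0 pN leq_addr.
Qed.

Lemma subexcedent_right (p q : seq nat) :
  subexcedent (p ++ 0 :: q) (size p).+2 = sub_right (npos p) q.
Proof.
rewrite /subexcedent /sub_right -(addn0 (size p).+2) letter_catr addn0 nth0.
rewrite -(addn1 (size p).+1) redw_catr /inrange size_cat.
by case: q => [|[|x] q] //=; rewrite /redw /= ?take0 ?addn1 ?andbF //=; case: leqP; lia.
Qed.

(** No positive letter equals its rank, so each one is either excedent or subexcedent. *)
Lemma nonsubE (w : seq nat) (k : nat) : derange 0 w ->
  nonsub w k = ~~ subexcedent w k.
Proof.
move/derangeP => dw; rewrite /nonsub /subexcedent /excedent.
case: (boolP (inrange w k)) => //= /andP[k0 kw].
case: (posnP (letter w k)) => [-> //|wk] /=.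
have := dw k.-1; rewrite prednK // => /(_ kw wk); rewrite -/(letter w k) add0n.
by case: ltngtP.
Qed.

Lemma mem_foldr_maxn (s : seq nat) (x : nat) : x \in s ->
  foldr maxn 0 s \in s /\ x <= foldr maxn 0 s.
Proof.
elim: s x => // y s IH x; rewrite inE /= => xs.
case: (posnP (size s)) => [/size0nil s0|sN].
  by move: xs; rewrite s0 !inE orbF maxn0 => /eqP ->.
have [y' ys] : exists y', y' \in s.
  by case: (s) sN => // y' s' _; exists y'; rewrite mem_head.
have [m_s _] := IH _ ys; split.
  by rewrite inE /maxn; case: ltnP => _; rewrite ?m_s ?eqxx ?orbT.
rewrite leq_max; case/orP: xs => [/eqP ->|/IH[_ ->]]; by rewrite ?leqnn ?orbT.
Qed.

Lemma head_filter_iota (a : pred nat) (m n x : nat) : x \in filter a (iota m n) ->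
  head 0 (filter a (iota m n)) \in filter a (iota m n) /\
  head 0 (filter a (iota m n)) <= x.
Proof.
have : sorted leq (filter a (iota m n)).
  by apply: sorted_filter (iota_sorted _ _); apply: leq_trans.
case: (filter a (iota m n)) => //= y s /(order_path_min leq_trans) /allP ys.
by rewrite mem_head inE => /orP[/eqP ->|/ys].
Qed.

(** Case (b): the zero jumps over the run [x :: c]. The negated clause expresses maximality: the
    next letter, whose rank if positive is [npos p + (size c).+2], is not both larger and
    subexcedent. *)
Lemma phi_right (p q : seq nat) : let w := p ++ 0 :: q in
  derange 0 w -> sub_right (npos p) q ->
  ~~ sub_left p || (head 0 q < last 0 p) ->
  exists x c d, [/\ q = (x :: c) ++ d, 0 < x, path ltn x c,
    last x c < npos p + (size c).+1 &
    [/\ ~~ (last x c < head 0 d < npos p + (size c).+2) &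
        phi_l (zero p).+1 w = p ++ (x :: c) ++ 0 :: d]].
Proof.
move=> w dw sR sL.
have sw : size w = size p + (size q).+1 by rewrite size_cat.
have zw : size w - count (fun x => 0 < x) w = zero w by rewrite -zero_npos addnK.
have ltz : (zero w < (zero p).+1) = false by rewrite zero_cat zero_cons; lia.
rewrite /phi_l zw ltz [_.+1.-1]/= nth_Zero [_.+1.-1]/=.
rewrite !nonsubE // subexcedent_left subexcedent_right sR andbF /=.
have -> : ~~ sub_left p && true || sub_left p && true &&
    (letter w (size p).+2 < letter w (size p)).
  case: (boolP (sub_left p)) sL => // lp /=.
  have pN : p != [::] by apply: contraTneq lp => ->.
  by rewrite letter_last // -(addn0 (size p).+2) letter_catr nth0.
set s := filter _ _; have qN : 0 < size q by case: (q) sR.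
have ltr i : letter w ((size p).+2 + i) = nth 0 q i by apply: letter_catr.
have [k_s _] : foldr maxn 0 s \in s /\ (size p).+2 <= foldr maxn 0 s.
  apply: mem_foldr_maxn; rewrite mem_filter mem_iota sw.
  have := subexcedent_right p q; rewrite sR /subexcedent => /andP[_ ->].
  by rewrite /incr_seg subnn /=; lia.
have k_max i : i \in s -> i <= foldr maxn 0 s by move=> /mem_foldr_maxn[].
move: (foldr maxn 0 s) k_s k_max => k; rewrite mem_filter mem_iota => /andP[/andP[]].
move=> inc sub_k /andP[k1 k2] k_max.
(* [i] is the index in [q], counted from 0, of the last letter of the run. *)
have [i ek] : exists i, k = (size p).+2 + i by exists (k - (size p).+2); lia.
have iq : i < size q by lia.
have sp : size (rcons p 0) = (size p).+1 by rewrite size_rcons.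
have ek' : k = size (rcons p 0) + i.+1 by rewrite sp ek addSnnS.
have wE : w = rcons p 0 ++ q by rewrite cat_rcons.
have etk : drop (size p).+1 (take k w) = take i.+1 q.
  by rewrite wE ek' take_cat ltnNge leq_addr addKn drop_size_cat.
have edk : drop k w = drop i.+1 q.
  by rewrite wE ek' drop_cat ltnNge leq_addr addKn.
have etp : take (size p) w = p by rewrite take_size_cat.
rewrite etk edk etp.
pose x := head 0 q; pose c := take i (behead q); pose d := drop i (behead q).
have qE : q = x :: behead q by rewrite /x; case: (q) qN.
have tq : take i.+1 q = x :: c by rewrite qE.
have dq : drop i.+1 q = d by rewrite qE.
have x0 : 0 < x by case/andP: sR.
have sc : size (x :: c) = i.+1 by rewrite -tq size_takel.
have xc : path ltn x c.
  rewrite -[path ltn x c]/(sorted ltn (x :: c)) -tq; apply/(sortedP 0) => t.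
  rewrite size_takel // => lt_t; rewrite !nth_take //; last exact: ltnW.
  rewrite -!ltr addnS; apply: (allP inc); rewrite mem_iota ek; lia.
have pos_c : npos (x :: c) = i.+1.
  rewrite -sc; apply/eqP; rewrite -all_count /= x0 /=.
  apply: sub_all (order_path_min ltn_trans xc) => y; exact: leq_ltn_trans.
have last_c : last x c = nth 0 q i.
  by rewrite -[last x c]/(last 0 (x :: c)) -nth_last sc -tq nth_take.
have redq : redw q i.+1 = i.+1 by rewrite /redw tq.
have {}sc : size c = i by case: sc.
have hr t : redw w ((size p).+1 + t) = npos p + redw q t by apply: redw_catr.
have rk : redw w k = npos p + i.+1 by rewrite ek addSnnS hr redq.
exists x, c, d; split=> //.
- by rewrite /c /d /= cat_take_drop.
- by move: sub_k; rewrite rk ek ltr last_c sc.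
split; last by rewrite tq dq.
apply/negP => /andP[lt1 lt2].
have iq' : i.+1 < size q.
  rewrite ltn_neqAle iq andbT; apply: contraTneq lt1 => e.
  by rewrite -dq e drop_size.
have hd : head 0 d = nth 0 q i.+1 by rewrite -nth0 -dq nth_drop addn0.
(* Otherwise the run could be prolonged by one letter, against the choice of [k]. *)
suff /k_max : k.+1 \in s by rewrite ltnn.
rewrite mem_filter mem_iota; apply/andP; split; last by lia.
have wk : letter w k = last x c by rewrite ek ltr last_c.
have wk1 : letter w k.+1 = head 0 d by rewrite ek -addnS ltr hd.
apply/andP; split; last first.
  rewrite wk1 redwS rk -[nth 0 w k]/(letter w k.+1) wk1 (leq_ltn_trans _ lt1) //.
  by move: lt2; rewrite sc; lia.
rewrite /incr_seg subSn //.
rewrite -(addn1 (k - _)) iotaD all_cat; apply/andP; split; first exact: inc.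
by rewrite subnKC //= ?wk1 ?wk ?lt1.
Qed.

(** Case (c), the mirror image: a decreasing run ending just before the zero, maximal to the left,
    whose first letter has rank [(npos d).+1]. *)
Lemma phi_left (p q : seq nat) : let w := p ++ 0 :: q in
  derange 0 w -> sub_left p ->
  ~~ sub_right (npos p) q || (last 0 p < head 0 q) ->
  exists d x c, [/\ p = d ++ x :: c, 0 < last x c, path gtn x c,
    x < (npos d).+1 &
    [/\ ~~ (x < last 0 d < npos d) &
        phi_l (zero p).+1 w = d ++ 0 :: (x :: c) ++ q]].
Proof.
move=> w dw sL sR.
have sw : size w = size p + (size q).+1 by rewrite size_cat.
have zw : size w - count (fun x => 0 < x) w = zero w by rewrite -zero_npos addnK.
have ltz : (zero w < (zero p).+1) = false by rewrite zero_cat zero_cons; lia.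
have pN : p != [::] by apply: contraTneq sL => ->.
have lastw : letter w (size p) = last 0 p by apply: letter_last.
rewrite /phi_l zw ltz [_.+1.-1]/= nth_Zero [_.+1.-1]/=.
rewrite !nonsubE // subexcedent_left subexcedent_right sL /= lastw.
rewrite -(addn0 (size p).+2) letter_catr nth0 addn0.
have -> : sub_right (npos p) q && (head 0 q < last 0 p) = false.
  by case: (sub_right _ _) sR => //= lt; rewrite ltnNge ltnW.
have -> : ~~ sub_right (npos p) q || sub_right (npos p) q && (last 0 p < head 0 q).
  by case: (sub_right _ _) sR.
set s := filter _ _.
have [i_s i_min] : head 0 s \in s /\ forall i, i \in s -> head 0 s <= i.
  have [] := @head_filter_iota
    (fun i => (letter w i < redw w i) && decr_seg w i (size p)) 1 (size p) (size p).
    rewrite mem_filter mem_iota /decr_seg subnn /= add1n ltnS leqnn andbT.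
    have := subexcedent_left p q; rewrite sL /subexcedent => /andP[_ ->].
    by rewrite lt0n size_eq0 pN.
  by split=> // i /head_filter_iota[].
move: (head 0 s) i_s i_min => i1; rewrite mem_filter mem_iota.
move=> /andP[/andP[sub_i dec] /andP[i0 ip]] i_min.
(* The run starts at position [i.+1], so [i] is the length of the prefix [d] before it. *)
case: i1 i0 ip sub_i dec i_min => // i _ ip sub_i dec i_min.
have {}ip : i < size p by lia.
pose d := take i p; pose x := nth 0 p i; pose c := drop i.+1 p.
have pE : p = d ++ x :: c by rewrite -drop_nth // cat_take_drop.
have sd : size d = i by rewrite size_takel // ltnW.
have ltl t : 0 < t <= size p -> letter w t = letter p t by apply: letter_catl.
have wi : letter w i.+1 = x by rewrite ltl.
have last_c : last x c = last 0 p by rewrite pE last_cat.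
have xc : path gtn x c.
  rewrite -[path gtn x c]/(sorted gtn (x :: c)) -drop_nth //.
  apply/(sortedP 0) => t; rewrite size_drop => lt_t; rewrite !nth_drop.
  rewrite -[nth 0 p (i + t)]/(letter p (i + t).+1).
  rewrite -[nth 0 p (i + t.+1)]/(letter p (i + t.+1).+1).
  rewrite -!ltl; [|lia|lia].
  rewrite addnS; apply: (allP dec); rewrite mem_iota; lia.
have c0 : 0 < last x c by rewrite last_c; case/andP: sL.
have x0 : 0 < x.
  by case: (c) xc c0 => //= y c' /andP[/(leq_ltn_trans _) ->].
have ri : redw w i = npos d by rewrite /w redw_catl // ltnW.
have ri1 : redw w i.+1 = (npos d).+1.
  by rewrite redwS ri -[nth 0 w i]/(letter w i.+1) wi x0 addn1.
exists d, x, c; split=> //; first by rewrite -ri1 -wi.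
split; last first.
  have -> : take i.+1.-1 w = d by rewrite /w takel_cat // ltnW.
  have -> : drop i.+1.-1 (take (size p) w) = x :: c.
    by rewrite /w take_size_cat // (drop_nth 0).
  have -> // : drop (size p).+1 w = q.
  by rewrite /w -cat_rcons drop_size_cat // size_rcons.
apply/negP => /andP[lt1 lt2].
have i0 : 0 < i by rewrite -sd; case: (d) lt1.
suff /i_min : i \in s by rewrite ltnn.
have wi' : letter w i = last 0 d.
  by rewrite ltl ?i0 ?(ltnW ip) // -nth_last sd nth_take //; lia.
rewrite mem_filter mem_iota; apply/andP; split; last by lia.
rewrite wi' ri lt2 /= /decr_seg.
rewrite -(subnSK ip) /= wi' wi lt1 /=; exact: dec.
Qed.

Lemma phi_stay (p q : seq nat) : let w := p ++ 0 :: q in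
  derange 0 w -> ~~ sub_left p -> ~~ sub_right (npos p) q ->
  phi_l (zero p).+1 w = w.
Proof.
move=> w dw sL sR.
have sw : size w = size p + (size q).+1 by rewrite size_cat.
have zw : size w - count (fun x => 0 < x) w = zero w by rewrite -zero_npos addnK.
have ltz : (zero w < (zero p).+1) = false by rewrite zero_cat zero_cons; lia.
rewrite /phi_l zw ltz [_.+1.-1]/= nth_Zero [_.+1.-1]/=.
by rewrite !nonsubE // subexcedent_left subexcedent_right sL sR.
Qed.

(** * One step [phi_l] leaves the rises of the keys unchanged *)

Lemma Pos_disjoint (s t : seq nat) (a : nat) :
  uniq (Pos (s ++ t)) -> 0 < a -> a \in s -> a \notin t.
Proof.
rewrite Pos_cat cat_uniq => /and3P[_ /hasPn st _] a0 a_s.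
by apply/negP => a_t; have := st a; rewrite !mem_filter /= a0 a_s a_t => /(_ isT).
Qed.

Lemma last_keys (M I0 r z x : nat) (p : seq nat) : zero (rcons p x) <= z ->
  last I0 (keys M r z (rcons p x)) =
  if x == 0 then 0 else if x < (r + npos p).+1 then x else M + x.
Proof.
rewrite -cats1 keys_cat last_cat zero_cat zero_cons /=.
by case: x => [|x] //=; case: (z - zero p) (subn_gt0 (zero p) z) => //=; lia.
Qed.

Lemma last_keys_sub (M I0 z : nat) (p : seq nat) : zero p <= z ->
  sub_left p -> last I0 (keys M 0 z p) = last 0 p.
Proof.
case/lastP: p => // p x zp; rewrite /sub_left last_keys // last_rcons.
by rewrite -cats1 npos_cat add0n; case: x {zp} => //= x; rewrite addn1 => ->.
Qed.

(** All zeros of [p] are small here, so the last key is 0, that of an excedent letter, or the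
    sentinel [I0]; to the right of the treated zero they are large, whence the single bound in
    [head_keys_nonsub]. *)
Lemma last_keys_nonsub (M I0 z : nat) (p : seq nat) : zero p <= z -> M < I0 ->
  ~~ sub_left p -> (M < last I0 (keys M 0 z p)) || (last I0 (keys M 0 z p) == 0).
Proof.
case/lastP: p => [|p x] zp MI; first by rewrite /= MI.
rewrite /sub_left last_keys // last_rcons -cats1 npos_cat add0n.
case: x {zp} => [_|x /=]; first by rewrite orbT.
by rewrite addn1 => /negbTE ->; rewrite addnS ltnS leq_addr.
Qed.

Lemma head_keys_sub (M I0 r : nat) (q : seq nat) :
  sub_right r q -> head I0 (keys M r 0 q) = head 0 q.
Proof. by case: q => [|[|x] q] //; rewrite /sub_right /= => ->. Qed.

Lemma head_keys_nonsub (M I0 r : nat) (q : seq nat) : M <= I0 ->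
  ~~ sub_right r q -> M <= head I0 (keys M r 0 q).
Proof.
by case: q => [|[|x] q] //; rewrite /sub_right /= => _ /negbTE ->; apply: leq_addr.
Qed.

(* The sentinel at both ends is the convention [x_0 = x_{n+1} = +oo]; only its
   position above large zeros and subexcedent letters matters. *)
Definition rises (M : nat) (K : seq nat) : seq bool := pairmap leq M.+1 (rcons K M.+1).

Lemma rcons_head (x : nat) (s : seq nat) :
  exists E, rcons s x = head x s :: E.
Proof. by case: s => [|y s]; eexists. Qed.

Lemma npos_incr (x : nat) (c : seq nat) : 0 < x -> path ltn x c ->
  zero (x :: c) = 0 /\ npos (x :: c) = (size c).+1.
Proof.
move=> x0 xc; suff e : npos (x :: c) = (size c).+1.
  by split=> //; have := zero_npos (x :: c); rewrite e /=; lia.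
apply/eqP; rewrite -[_.+1]/(size (x :: c)) -all_count /= x0 /=.
apply: sub_all (order_path_min ltn_trans xc) => y; exact: leq_ltn_trans.
Qed.

Lemma npos_decr (x : nat) (c : seq nat) : 0 < last x c -> path gtn x c ->
  zero (x :: c) = 0 /\ npos (x :: c) = (size c).+1.
Proof.
move=> c0 xc; suff e : npos (x :: c) = (size c).+1.
  by split=> //; have := zero_npos (x :: c); rewrite e /=; lia.
elim: c x c0 xc => [|y c IH] x /=; first by rewrite /npos /= => ->.
move=> c0 /andP[yx yc]; have := IH y c0 yc; rewrite /npos /= => ->.
by rewrite (leq_ltn_trans _ yx).
Qed.

(** The three cases of [phi_l] match [rises_stay], [rises_right] and [rises_left]. The second claim,
    that one zero is taken out and put back without passing another zero, is what injectivity
    needs. *)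
Lemma phi_keys (M : nat) (p q : seq nat) : let w := p ++ 0 :: q in
  derange 0 w -> uniq (Pos w) -> all (fun x => x < M) w ->
  rises M (keys M 0 (zero p) (phi_l (zero p).+1 w)) =
    rises M (keys M 0 (zero p).+1 w) /\
  exists p' q', [/\ phi_l (zero p).+1 w = p' ++ 0 :: q', p' ++ q' = p ++ q &
                    zero p' = zero p].
Proof.
move=> w dw uw wM.
(* The two values of [z] differ only in the key of the treated zero; zeros before it are small and
   zeros after it large in both. *)
have keysE z (p1 q1 : seq nat) : zero p1 = zero p -> z = zero p \/ z = (zero p).+1 ->
    keys M 0 z (p1 ++ 0 :: q1) = keys M 0 (zero p) p1 ++
      (if z == zero p then M else 0) :: keys M (npos p1) 0 q1.
  move=> zp1 [] ->; rewrite keys_cat zp1.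
    by rewrite subnn eqxx.
  by rewrite subSnn gtn_eqF // (@keys_zero _ _ _ (zero p)) ?zp1.
have w_lt y : y \in w -> y < M by apply: (allP wM).
pose KP := keys M 0 (zero p) p.
have [/andP[sL sR]|] := boolP (~~ sub_left p && ~~ sub_right (npos p) q).
  rewrite phi_stay //; split; last by exists p, q.
  rewrite /w !keysE ?eqxx ?gtn_eqF //; [|by right|by left].
  rewrite /rises !rcons_cat /=.
  have [E ->] := rcons_head M.+1 (keys M (npos p) 0 q).
  by rewrite -rises_stay ?last_keys_nonsub ?head_keys_nonsub.
move=> not_stay.
have [/andP[sR sL]|] := boolP (sub_right (npos p) q &&
    (~~ sub_left p || (head 0 q < last 0 p))).
  have [x [c [d [qE x0 xc lt_c [maxc ->]]]]] := phi_right dw sR sL.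
  have [zc nc] := npos_incr x0 xc.
  have z1 : zero (p ++ x :: c) = zero p by rewrite zero_cat zc addn0.
  split; last by exists (p ++ x :: c), d; rewrite -!catA qE z1.
  rewrite catA /w !keysE ?eqxx ?gtn_eqF //; [|by right|by left].
  rewrite qE !keys_cat !add0n subnn zc subn0 nc npos_cat nc.
  have [xr ->] := keys_incr M 0 x0 xc lt_c.
  rewrite /rises !rcons_cat /= !rcons_cat -/KP -catA.
  set r := npos p + (size c).+1.
  have [E ->] := rcons_head M.+1 (keys M r 0 d).
  symmetry; rewrite -cat_cons; apply: rises_right => //.
  - by apply: w_lt; rewrite mem_cat inE qE mem_cat mem_last !orbT.
  - have xM : x < M by apply: w_lt; rewrite mem_cat inE qE mem_cat mem_head !orbT.
    have [sub_p|nsub_p] := boolP (sub_left p).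
      by rewrite last_keys_sub //; move: sL; rewrite sub_p qE /= => ->; rewrite orbT.
    case/orP: (@last_keys_nonsub M M.+1 _ p (leqnn _) (ltnSn M) nsub_p) => [lt|->] //.
    by rewrite (ltn_trans xM) ?orbT.
  (* A subexcedent letter after the run is smaller than the end of the run: not larger by
     maximality, not equal because positive letters are distinct. *)
  - have [sub_d|nsub_d] := boolP (sub_right r d); last by rewrite head_keys_nonsub.
    rewrite head_keys_sub // ltn_neqAle; apply/orP; right.
    have d0 : 0 < head 0 d by case/andP: sub_d.
    have dN : head 0 d \in d by case: (d) d0 => // y d' _; rewrite mem_head.
    apply/andP; split.
      apply: contraL dN => /eqP ->; apply: (Pos_disjoint (s := p ++ 0 :: x :: c)).
      + by rewrite -catA /= -cat_cons -qE.
      + by apply: leq_trans x0 _; case: (c) xc => // y c'; move=> h;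
          apply: ltnW; apply: (allP (order_path_min ltn_trans h)); apply: mem_last.
      + by rewrite mem_cat inE mem_last !orbT.
    rewrite leqNgt; apply: contra maxc => ->.
    by case/andP: sub_d => _; rewrite /r !addnS.
move=> not_right.
have sL : sub_left p.
  by case: (sub_left p) not_stay not_right => //=; case: sub_right.
(* Two equal subexcedent neighbours, left open by cases (b) and (c), are excluded by uniqueness of
   positive letters. *)
have sR : ~~ sub_right (npos p) q || (last 0 p < head 0 q).
  case: (boolP (sub_right _ _)) not_right => //= sR.
  rewrite sL /= -leqNgt leq_eqVlt => /orP[/eqP e|//].
  have p0 : 0 < last 0 p by case/andP: sL.
  have q0 : 0 < head 0 q by case/andP: sR.
  have lp : last 0 p \in p by case: (p) p0 => // y p' _; apply: mem_last.
  have hq : head 0 q \in 0 :: q.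
    by case: (q) q0 => // y q' _; rewrite !inE eqxx orbT.
  by have := Pos_disjoint uw p0 lp; rewrite e hq.
have [d [x [c [pE c0 xc lt_x [minc ->]]]]] := phi_left dw sL sR.
have [zc nc] := npos_decr c0 xc.
have z1 : zero d = zero p by rewrite pE zero_cat zc addn0.
split; last by exists d, (x :: c ++ q); split; rewrite // pE -catA.
rewrite /w !keysE ?eqxx ?gtn_eqF //; [|by right|by left].
rewrite -z1 pE !keys_cat !add0n subnn zc subn0 nc npos_cat nc.
have [x0 ->] := keys_decr M 0 c0 xc lt_x.
rewrite /rises !rcons_cat /= !rcons_cat -catA.
have [E] := rcons_head M.+1 (keys M (npos d + (size c).+1) 0 q) => ->.
symmetry; rewrite -cat_cons; apply: rises_left => //.
- by apply: w_lt; rewrite /w pE !mem_cat mem_head orbT.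
- have [sub_d|nsub_d] := boolP (sub_left d); last first.
    have [lt|/eqP ->] := orP (@last_keys_nonsub M M.+1 (zero d) d (leqnn _) (ltnSn M) nsub_d).
      by rewrite lt.
    by rewrite x0 orbT.
  rewrite last_keys_sub // [_ < x]ltn_neqAle; apply/orP; right.
  have d0 : 0 < last 0 d by case/andP: sub_d.
  have dN : last 0 d \in d by case: (d) d0 => // y d' _; apply: mem_last.
  have uw' : uniq (Pos (d ++ x :: c ++ 0 :: q)) by rewrite -cat_cons catA -pE.
  apply/andP; split; last first.
    by rewrite leqNgt; apply: contra minc => ->; case/andP: sub_d.
  by apply: contraNneq (Pos_disjoint uw' d0 dN) => ->; rewrite mem_head.
- have [sub_q|nsub_q] := boolP (sub_right (npos d + (size c).+1) q).
    rewrite head_keys_sub //; move: sR; rewrite pE npos_cat nc sub_q last_cat.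
    by [].
  apply: leq_trans (head_keys_nonsub _ nsub_q); last exact: leqnSn.
  by apply: w_lt; rewrite /w pE !mem_cat mem_last orbT.
Qed.

(** * The map Phi *)

Lemma derangement_word_bounds (M : nat) (w : seq nat) : derangement_word (Pos w) -> size w < M ->
  [/\ derange 0 w, uniq (Pos w) & all (fun x => x < M) w].
Proof.
case/and3P=> uw; rewrite derange_Pos size_Pos => dw /allP mw ltM; split=> //.
apply/allP => x xw; case: (posnP x) => [-> |x0]; first exact: leq_ltn_trans ltM.
apply: leq_ltn_trans ltM; apply: leq_trans (count_size _ w).
by apply: mw; rewrite mem_filter x0.
Qed.

Lemma split_zero_inj (p q p2 q2 : seq nat) : zero p = zero p2 ->
  p ++ 0 :: q = p2 ++ 0 :: q2 -> p = p2 /\ q = q2.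
Proof.
elim: p p2 => [|x p IH] [|y p2] //=; rewrite ?zero_cons.
- by move=> _ [].
- by move=> + [e _]; rewrite -e.
- by move=> + [e _]; rewrite e.
by move=> zp [e e2]; move: zp; rewrite e => /addnI /IH /(_ e2) [-> ->].
Qed.

Lemma phi_big (l : nat) (w : seq nat) : zero w < l -> phi_l l w = w.
Proof.
move=> h; rewrite /phi_l.
have -> : size w - count (fun x => 0 < x) w = zero w by rewrite -zero_npos addnK.
by rewrite h.
Qed.

Lemma phi_step (M l : nat) (w : seq nat) : derangement_word (Pos w) -> size w < M ->
  [/\ size (phi_l l.+1 w) = size w, Pos (phi_l l.+1 w) = Pos w &
      rises M (keys M 0 l (phi_l l.+1 w)) = rises M (keys M 0 l.+1 w)].
Proof.
move=> gw wM; have [dw uw aw] := derangement_word_bounds gw wM.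
have [le|lt] := leqP (zero w) l.
  by rewrite phi_big ?ltnS // (@keys_zero _ _ l l.+1) // ltnW.
have [p [q [ew zp]]] := split_zero lt.
have := @phi_keys M p q; rewrite -ew zp => /(_ dw uw aw).
case=> -> [p' [q' [-> epq _]]]; split=> //.
  by rewrite ew !size_cat /= !addnS -!size_cat epq.
by rewrite ew !Pos_cat /= -!Pos_cat epq.
Qed.

(** The image determines both the word with its treated zero deleted and, by [phi_keys], the rises
    of the keys in which that zero is small. [pairmap_insert] then locates the zero, and [keysK]
    decodes the keys. *)
Lemma phi_inj (l : nat) (w1 w2 : seq nat) : derangement_word (Pos w1) ->
  size w1 = size w2 -> Pos w1 = Pos w2 ->
  phi_l l.+1 w1 = phi_l l.+1 w2 -> w1 = w2.
Proof.
move=> g1 es eP ephi; have g2 : derangement_word (Pos w2) by rewrite -eP.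
pose M := (size w1).+1.
have m1 : size w1 < M by []; have m2 : size w2 < M by rewrite -es.
have [d1 u1 a1] := derangement_word_bounds g1 m1; have [d2 u2 a2] := derangement_word_bounds g2 m2.
have ez : zero w1 = zero w2.
  by apply/eqP; rewrite -(eqn_add2r (npos w1)) zero_npos es -size_Pos eP size_Pos zero_npos.
have [le|lt1] := leqP (zero w1) l.
  by move: ephi; rewrite !phi_big // ltnS -?ez.
have lt2 : l < zero w2 by rewrite -ez.
have [p1 [q1 [e1 zp1]]] := split_zero lt1.
have [p2 [q2 [e2 zp2]]] := split_zero lt2.
have := @phi_keys M p1 q1; rewrite -e1 zp1 => /(_ d1 u1 a1).
have := @phi_keys M p2 q2; rewrite -e2 zp2 => /(_ d2 u2 a2).
rewrite -ephi => -[-> [p2' [q2' [ph2 pq2 zp2']]]] [eqr [p1' [q1' [ph1 pq1 zp1']]]].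
have {ph1 ph2} [ep' eq'] : p1' = p2' /\ q1' = q2'.
  by apply: split_zero_inj; [rewrite zp1' zp2'|rewrite -ph1 -ph2].
have epq : p1 ++ q1 = p2 ++ q2 by rewrite -pq1 -pq2 ep' eq'.
have keysE p q : zero p = l -> keys M 0 l.+1 (p ++ 0 :: q) =
    keys M 0 l p ++ 0 :: keys M (npos p) 0 q.
  by move=> zp; rewrite keys_cat zp subSnn (@keys_zero _ _ _ l) ?zp.
have keys2 p q : zero p = l -> keys M 0 l p ++ keys M (npos p) 0 q = keys M 0 l (p ++ q).
  by move=> zp; rewrite keys_cat zp subnn.
have ek : keys M 0 l.+1 w1 = keys M 0 l.+1 w2.
  move: eqr; rewrite e1 e2 !keysE // /rises !rcons_cat /= => /esym/pairmap_insert.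
  rewrite -!rcons_cat !keys2 // epq => /(_ erefl).
  by rewrite -!rcons_cons -!rcons_cat => /rcons_inj[].
by rewrite -(keysK 0 l.+1 a1) ek keysK.
Qed.

(** [foldr] applies the largest index first, so the zeros become large one by one from right to
    left. *)
Lemma phi_iter (M l c : nat) (w : seq nat) : derangement_word (Pos w) -> size w < M ->
  let w' := foldr phi_l w (iota l.+1 c) in
  [/\ size w' = size w, Pos w' = Pos w &
      rises M (keys M 0 l w') = rises M (keys M 0 (l + c) w)].
Proof.
move=> gw wM; elim: c l => [|c IH] l /=; first by rewrite addn0.
case: (IH l.+1) => s1 p1 r1; rewrite -p1 in gw; rewrite -s1 in wM.
by case: (phi_step l gw wM) => -> -> ->; rewrite r1 addSnnS.
Qed.

Lemma phi_iter_inj (l c : nat) (w1 w2 : seq nat) : derangement_word (Pos w1) ->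
  size w1 = size w2 -> Pos w1 = Pos w2 ->
  foldr phi_l w1 (iota l.+1 c) = foldr phi_l w2 (iota l.+1 c) -> w1 = w2.
Proof.
move=> g1 es eP; have g2 : derangement_word (Pos w2) by rewrite -eP.
elim: c l => [|c IH] l //= /phi_inj e; apply: (IH l.+1); apply: e.
- by case: (phi_iter l.+1 c g1 (ltnSn _)) => _ ->.
- case: (phi_iter l.+1 c g1 (ltnSn _)) => -> _ _.
  by case: (phi_iter l.+1 c g2 (ltnSn _)) => ->.
case: (phi_iter l.+1 c g1 (ltnSn _)) => _ -> _.
by case: (phi_iter l.+1 c g2 (ltnSn _)) => _ ->.
Qed.

(** * Rises of the keys when all zeros are small or all are large *)

Lemma RISE_nth (w1 w2 : seq nat) : size w1 = size w2 ->
  (forall i, i.+1 < size w1 ->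
     (nth 0 w1 i <= nth 0 w1 i.+1) = (nth 0 w2 i <= nth 0 w2 i.+1)) ->
  RISE w1 = RISE w2.
Proof.
move=> es H; rewrite /RISE es; apply: eq_in_filter => i; rewrite mem_iota.
case: i => // i /= lti; rewrite /letter /=; case: eqVneq => //= ne.
by apply: H; lia.
Qed.

Lemma RISE_rises (M : nat) (K1 K2 : seq nat) : size K1 = size K2 ->
  rises M K1 = rises M K2 -> RISE K1 = RISE K2.
Proof.
move=> es e; apply: RISE_nth => // i lti.
have H (K : seq nat) : i.+1 < size K ->
    nth true (rises M K) i.+1 = (nth 0 K i <= nth 0 K i.+1).
  move=> lt; rewrite /rises (nth_pairmap 0) ?size_rcons //; last exact: ltnW.
  by rewrite /= !nth_rcons lt (ltnW lt).
by rewrite -!H -?es // e.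
Qed.

(** Ranks of adjacent positive letters differ by one, so an excedent letter already exceeds a
    subexcedent neighbour; shifting it by [M] changes no comparison. *)
Lemma RISE_keys_small (M : nat) (w : seq nat) : derange 0 w ->
  size w < M -> all (fun x => x < M) w -> RISE (keys M 0 (size w) w) = RISE w.
Proof.
move=> /derangeP dw sM wM; apply: RISE_nth; rewrite size_keys // => i lti.
have zs j : j < size w -> zero (take j w) < size w.
  move=> ltj; have := zero_npos (take j w).
  by rewrite size_takel; [lia|exact: ltnW].
have lti' := ltnW lti; rewrite !nth_keys // !zs // [redw w i.+2]redwS !add0n.
have := dw i lti'; have := dw i.+1 lti; rewrite [redw w i.+2]redwS !add0n.
have aM : nth 0 w i < M by apply: (allP wM); apply: mem_nth.
move: (nth 0 w i) (nth 0 w i.+1) (redw w i.+1) aM => a b r aM.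
case: a aM => [|a] aM; case: b => [|b] //=; first by case: (ltnP a.+1 r); lia.
move=> /(_ isT) nb /(_ isT) na.
by case: (ltnP a.+1 r); case: (ltnP b.+1 (r + 1)); lia.
Qed.

Lemma redw_ltn (w : seq nat) (i j : nat) : 0 < nth 0 w j ->
  i < j -> redw w i.+1 < redw w j.+1.
Proof.
by move=> wj /(redw_leq w); rewrite [redw w j.+1]redwS wj addn1 ltnS.
Qed.

(** Ranking preserves the order of non-fixed points, hence also excedance. As values are distinct, a
    fixed point exceeds an adjacent subexcedent value and lies below an adjacent excedent one,
    exactly like a large zero; two adjacent fixed points form a rise, as two keys [M] do. *)
Lemma RISE_keys_large n (t : 'S_n) (M : nat) (w : seq nat) : ZDer t = w ->
  n < M -> all (fun x => x < M) w -> RISE (keys M 0 0 w) = RISE (pword t).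
Proof.
move=> /ZDer_ofP [sw hw] nM wM.
have sp : size (pword t) = n by rewrite size_map size_enum_ord.
apply: RISE_nth; rewrite size_keys ?sw ?sp // => i lti.
have lti' := ltnW lti.
pose i0 := Ordinal lti'; pose i1 := Ordinal lti.
have pw (k : 'I_n) : nth 0 (pword t) k = (t k).+1.
  by rewrite (nth_map k) ?size_enum_ord ?nth_ord_enum.
rewrite (pw i0) (pw i1) !nth_keys ?sw // !ltn0 !add0n ltnS.
have t_neq : t i0 != t i1 :> nat.
  by rewrite val_eqE (inj_eq perm_inj) -val_eqE /= neq_ltn ltnSn.
have tpos (k : 'I_n) : 0 < nth 0 w k -> 0 < nth 0 w (t k).
  by rewrite !lt0n !(hw _).1 (inj_eq perm_inj).
have lt_t (k : 'I_n) : 0 < nth 0 w k ->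
    (nth 0 w k < redw w k.+1) = (t k < k) /\ t k != k :> nat.
  move=> wk; rewrite -((hw k).2 wk) val_eqE -(hw k).1 -lt0n wk; split=> //.
  case: (ltngtP (t k) k) => [lt|lt|e]; first exact: redw_ltn.
    by apply/negbTE; rewrite -leqNgt; apply/ltnW/redw_ltn => //; apply: tpos.
  by rewrite e ltnn.
have le_t (k k' : 'I_n) : 0 < nth 0 w k -> 0 < nth 0 w k' ->
    (nth 0 w k <= nth 0 w k') = (t k <= t k').
  move=> wk wk'; rewrite -((hw k).2 wk) -((hw k').2 wk').
  case: (leqP (t k) (t k')) => [le|lt]; first by apply: redw_leq.
  by apply/negbTE; rewrite -ltnNge; apply: redw_ltn => //; apply: tpos.
have fix0 (k : 'I_n) : nth 0 w k = 0 -> t k = k :> nat.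
  by move=> wk; have := (hw k).1; rewrite wk => /esym/eqP ->.
have aM k : k < n -> nth 0 w k < M.
  by move=> ltk; apply: (allP wM); apply: mem_nth; rewrite sw.
move: (lt_t i0) (lt_t i1) (le_t i0 i1) (fix0 i0) (fix0 i1) t_neq (aM _ lti') (aM _ lti).
move: (t i0 : nat) (t i1 : nat) => x y; rewrite /i0 /i1 /=.
move: (nth 0 w i) (nth 0 w i.+1) (redw w i.+1) (redw w i.+2) => a b r r'.
case: a => [|a]; case: b => [|b] //=.
- by move=> _ _ _ /(_ erefl) -> /(_ erefl) ->; lia.
- by move=> _ /(_ isT) [-> ne] _ /(_ erefl) -> _ nexy _ bM; case: (ltnP y i.+1); lia.
- move=> /(_ isT) [-> ne] _ _ _ /(_ erefl) -> nexy aM' _.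
  by case: (ltnP x i); lia.
move=> /(_ isT) [-> ne] /(_ isT) [-> ne'] /(_ isT isT) le _ _ nexy aM' bM'.
by case: (ltnP x i); case: (ltnP y i.+1); lia.
Qed.

(** Among the positions before the last, descents are the complement of rises. *)
Lemma maj_RISE (w1 w2 : seq nat) : size w1 = size w2 ->
  RISE w1 = RISE w2 -> maj w1 = maj w2.
Proof.
have H (w : seq nat) : DES w = [seq i <- iota 1 (size w).-1 | i \notin RISE w].
  apply: eq_in_filter => i; rewrite mem_iota mem_filter mem_iota => hi.
  have -> : (i == size w) = false by lia.
  by rewrite /= ltnNge; case: (letter w i <= _) => //=; lia.
by move=> es eR; rewrite /maj !H es eR.
Qed.

(** * Transfer to permutations *)

Lemma fixpE n (s : 'S_n) : fixp s = n - size (Der s).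
Proof.
have [sw hw] : ZDer_of s (ZDer s) by apply/ZDer_ofP.
have -> : n - size (Der s) = zero (ZDer s).
  by have := zero_npos (ZDer s); rewrite sw /Der size_Pos; lia.
rewrite zero_count /ZDer count_map.
rewrite /fixp cardE size_filter -enumT; apply: eq_count => i.
by rewrite /= -nth_ZDer (hw i).1.
Qed.

Lemma Phi_permE n (s : 'S_n) : ZDer (Phi_perm s) = bfPhi (ZDer s).
Proof.
rewrite /Phi_perm; case: pickP => [t /eqP //|].
have gs : derangement_word (Pos (ZDer s)) by apply: Der_derangement.
have [sz eP _] := phi_iter 0 (size (ZDer s)) gs (ltnSn _).
have [||t et] := @ZDer_onto n (bfPhi (ZDer s)); first by rewrite sz size_ZDer.
  by rewrite /bfPhi eP.
by move/(_ t); rewrite et eqxx.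
Qed.

Lemma F3_permE n (s : 'S_n) : ZDer (F3_perm s) = bfF3 (ZDer s).
Proof.
rewrite /F3_perm; case: pickP => [t /eqP //|].
have [sz eP _] := bfF3_shuffle (ZDer s).
have [||t et] := @ZDer_onto n (bfF3 (ZDer s)); first by rewrite sz size_ZDer.
  by rewrite eP; apply: Der_derangement.
by move/(_ t); rewrite et eqxx.
Qed.

Lemma Der_Phi n (s : 'S_n) : Der (Phi_perm s) = Der s.
Proof.
rewrite /Der Phi_permE.
by case: (phi_iter 0 (size (ZDer s)) (Der_derangement s) (ltnSn _)).
Qed.

Lemma Der_F3 n (s : 'S_n) : Der (F3_perm s) = Der s.
Proof. by rewrite /Der F3_permE; case: (bfF3_shuffle (ZDer s)). Qed.

(** The rises of [ZDer s] are those of its keys with all zeros small; [phi_iter] carries them to the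
    keys of the image with all zeros large, whose rises are those of the permutation. *)
Lemma RIZE_Phi n (s : 'S_n) : RIZE s = RISE (pword (Phi_perm s)).
Proof.
set w := ZDer s; have sw : size w = n := size_ZDer s.
have wM : size w < n.+1 by rewrite sw.
have gw : derangement_word (Pos w) := Der_derangement s.
have [dw _ aw] := derangement_word_bounds gw wM.
have [s' p' r'] := phi_iter 0 (size w) gw wM.
rewrite -/(bfPhi w) -/(bfPhi _) in s' p' r'.
have [_ _ aw'] : [/\ derange 0 (bfPhi w), uniq (Pos (bfPhi w))
    & all (fun x => x < n.+1) (bfPhi w)].
  by apply: derangement_word_bounds; rewrite ?p' ?s'.
rewrite -(RISE_keys_large (Phi_permE s) (ltnSn n)) // -/w.
rewrite (RISE_rises _ r') ?size_keys // add0n.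
by rewrite RISE_keys_small.
Qed.

Theorem theorem1p4 (n : nat) :
  (forall s : 'S_n, ZDer (Phi_perm s) = bfPhi (ZDer s)) /\
      (forall s : 'S_n, ZDer (F3_perm s) = bfF3 (ZDer s)) /\
      bijective (@Phi_perm n) /\ bijective (@F3_perm n) /\
      (forall s : 'S_n,
         (fixp s, RIZE s, Der s) =
         (fixp (Phi_perm s), RISE (pword (Phi_perm s)), Der (Phi_perm s))) /\
      (forall s : 'S_n,
         (fixp s, maz s, Der s) =
         (fixp (F3_perm s), maf (F3_perm s), Der (F3_perm s))) /\
      (forall Phi_inv : 'S_n -> 'S_n,
         cancel (@Phi_perm n) Phi_inv -> cancel Phi_inv (@Phi_perm n) ->
         forall s : 'S_n,
         (fixp s, majp s, Der s) =
         (fixp (F3_perm (Phi_inv s)), maf (F3_perm (Phi_inv s)),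
          Der (F3_perm (Phi_inv s)))).
Proof.
have maz_F3 (s : 'S_n) : maz s = maf (F3_perm s).
  by rewrite /maf F3_permE; apply: maj_bfF3.
split; first exact: Phi_permE.
split; first exact: F3_permE.
split.
  (* On the finite set of permutations injectivity suffices; the invariance of [Der] supplies the
     equal positive subwords required. *)
  apply: injF_bij => s t e; apply: ZDer_inj.
  have eD : Der s = Der t by rewrite -Der_Phi e Der_Phi.
  have es : size (ZDer s) = size (ZDer t) by rewrite !size_ZDer.
  apply: (phi_iter_inj (l := 0) (c := n)) es eD _; first exact: Der_derangement.
  by have := congr1 (@ZDer n) e; rewrite !Phi_permE /bfPhi !size_ZDer.
split.
  apply: injF_bij => s t e; apply/ZDer_inj/bfF3_inj.
    by rewrite -/(Der s) -/(Der t) -Der_F3 e Der_F3.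
  by rewrite -!F3_permE e.
(* By [fixpE] the equality of [fixp] follows from that of [Der]. *)
split=> [s|]; first by rewrite !fixpE Der_Phi RIZE_Phi.
split=> [s|Phi_inv _ PhiK s]; first by rewrite !fixpE Der_F3 maz_F3.
(* Writing [s] as the image of [Phi_inv s] reduces the claim to [majp s] being [maz (Phi_inv s)],
   which holds because rises determine [maj]. *)
rewrite -{1 2 3}(PhiK s) !fixpE Der_F3 Der_Phi -maz_F3.
rewrite /majp /maz -(@maj_RISE (ZDer (Phi_inv s))) ?size_ZDer //; last first.
  exact: RIZE_Phi.
by rewrite size_map size_enum_ord.
Qed.
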